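(* Let $H$ be a separable Hilbert space, $\varphi^n,\varphi:H\to[0,+\infty]$ proper, l.s.c., convex functionals, and $(\Omega,\mathcal A,\mu)$ a complete, totally $\sigma$-finite measure space. For $u\in L^2(\Omega,\mu;H)$ put $\bar\varphi(u)=\int_\Omega\varphi(u(\omega))\,\mu(d\omega)$ and $\bar\varphi^n(u)=\int_\Omega\varphi^n(u(\omega))\,\mu(d\omega)$. Suppose that either condition (N) holds for $\bar\varphi^n,\bar\varphi$ on $L^2(\Omega,\mu;H)$, or $\mu$ is a finite measure. If $\varphi^n\to\varphi$ in Mosco sense on $H$, then $\bar\varphi^n\to\bar\varphi$ in Mosco sense on $L^2(\Omega,\mu;H)$.
   Context: Mosco convergence on a Hilbert space $E$: $\psi^n\to\psi$ if (a) for every sequence $u^n\rightharpoonup u$ weakly in $E$, $\liminf_n\psi^n(u^n)\ge\psi(u)$, and (b) for every $v\in E$ there are $v^n\to v$ strongly in $E$ with $\limsup_n\psi^n(v^n)\le\psi(v)$. Condition (N) for proper convex l.s.c. $\psi^n,\psi$ on a Hilbert space $E$: there exist $(u^n,v^n)\in E\times E$ with $v^n\in\partial\psi^n(u^n)$ for all $n$ and $(u,v)\in E\times E$ with $v\in\partial\psi(u)$ such that $u^n\to u$ and $v^n\to v$ strongly in $E$. Here $\partial$ denotes the subdifferential. *)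

(* Defs.v *)
From HB Require Import structures.
From mathcomp Require Import all_boot all_order all_algebra.
From mathcomp Require Import all_classical all_reals all_analysis.
Set Implicit Arguments. Unset Strict Implicit. Unset Printing Implicit Defensive.
Import Order.TTheory GRing.Theory Num.Theory.
Import numFieldNormedType.Exports.
Local Open Scope classical_set_scope.
Local Open Scope ring_scope.

Section Defs.
Context {R : realType}.

(* ip is an inner product on the normed space H inducing its norm;
   together with completeness of H this makes H a (real) Hilbert space. *)
Definition is_inner_product (H : normedModType R) (ip : H -> H -> R) :=
  [/\ forall x y, ip x y = ip y x,
      forall (a : R) x y z, ip (a *: x + y) z = a * ip x z + ip y z
    & forall x, ip x x = `|x| ^+ 2].

Definition separable (H : topologicalType) :=
  exists D : set H, countable D /\ closure D = setT.

Definition nonneg_fun {H : Type} (f : H -> \bar R) := forall x, (0 <= f x)%E.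
Definition proper_fun {H : Type} (f : H -> \bar R) := exists x, (f x < +oo)%E.
Definition convex_fun {H : lmodType R} (f : H -> \bar R) :=
  forall x y (t : R), 0 <= t <= 1 ->
    (f (t *: x + (1 - t) *: y)%R <= t%:E * f x + (1 - t)%:E * f y)%E.

(* generic Mosco convergence on a space E whose elements are those in X,
   with weak convergence wcvg and strong convergence scvg *)
Definition Mosco {E : Type} (X : set E)
  (wcvg scvg : (nat -> E) -> E -> Prop)
  (psin : nat -> E -> \bar R) (psi : E -> \bar R) :=
  (forall (un : nat -> E) u, (forall n, X (un n)) -> X u -> wcvg un u ->
      (psi u <= limn_einf (fun n => psin n (un n)))%E) /\
  (forall v, X v -> exists vn : nat -> E,
      [/\ forall n, X (vn n), scvg vn v &
          (limn_esup (fun n => psin n (vn n)) <= psi v)%E]).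

Definition weak_cvg {H : normedModType R} (ip : H -> H -> R)
  (un : nat -> H) (u : H) :=
  forall w, (fun n => ip (un n) w) @ \oo --> ip u w.
Definition strong_cvg {H : normedModType R} (un : nat -> H) (u : H) :=
  un @ \oo --> u.

Section L2.
Context {d : measure_display} {T : measurableType d}
  (mu : {measure set T -> \bar R}) {H : normedModType R} (ip : H -> H -> R).

Definition simple_fun (s : T -> H) :=
  finite_set (range s) /\ forall y, measurable (s @^-1` [set y]).

Definition strongly_measurable (u : T -> H) :=
  exists s : nat -> T -> H, (forall k, simple_fun (s k)) /\
    {ae mu, forall x, (fun k => s k x) @ \oo --> u x}.

Definition L2 : set (T -> H) := fun u =>
  strongly_measurable u /\ (\int[mu]_x ((`|u x| ^+ 2)%:E) < +oo)%E.

Definition L2ip (u v : T -> H) : R := fine (\int[mu]_x (ip (u x) (v x))%:E)%E.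

Definition L2_weak_cvg (un : nat -> T -> H) (u : T -> H) :=
  forall w, L2 w -> (fun n => L2ip (un n) w) @ \oo --> L2ip u w.

Definition L2_strong_cvg (un : nat -> T -> H) (u : T -> H) :=
  (fun n => (\int[mu]_x ((`|un n x - u x| ^+ 2)%:E))%E) @ \oo --> 0%E.

Definition L2_subdiff (psi : (T -> H) -> \bar R) (u v : T -> H) :=
  L2 u /\ L2 v /\ (psi u < +oo)%E /\
  forall w, L2 w -> (psi u + (L2ip v (fun x => w x - u x))%:E <= psi w)%E.

Definition condN (psin : nat -> (T -> H) -> \bar R) (psi : (T -> H) -> \bar R) :=
  exists (un vn : nat -> T -> H) (u v : T -> H),
    [/\ forall n, L2_subdiff (psin n) (un n) (vn n),
        L2_subdiff psi u v,
        L2_strong_cvg un u & L2_strong_cvg vn v].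

Definition integral_functional (phi : H -> \bar R) (u : T -> H) : \bar R :=
  (\int[mu]_x phi (u x))%E.

End L2.
End Defs.

(* Main.v *)
Require Import Defs.
From HB Require Import structures.
From mathcomp Require Import all_boot all_order all_algebra.
From mathcomp Require Import all_classical all_reals all_analysis.
From mathcomp Require Import measurable_realfun ring lra.

(** For k > 0 and f proper, l.s.c., convex and nonnegative, let J_k y be the
    minimiser of f + (k/2)|. - y|^2 and E_k y := f (J_k y) + k |y - J_k y|^2.
    Then E_k y + k <y - J_k y, w - y> <= f w for all w; in particular
    E_k <= f, and f <= liminf_k E_k by lower semicontinuity.

    Weak sequential compactness in H turns Mosco convergence of phi^n into
    pointwise convergence of J^n_k and E^n_k.  On L2 these converge by
    dominated convergence: J^n_k is nonexpansive and J^n_k 0 is bounded, which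
    suffices when mu is finite; when mu is infinite, the existence of an L2
    function of finite energy forces phi^n 0 = phi 0 = 0, hence J^n_k 0 = 0.

    Liminf: integrating the inequality above at y = u, w = u^n gives
    int E_k u <= liminf int phi^n u^n, because a strongly convergent sequence
    pairs well with a weakly convergent one; then let k -> oo with Fatou.
    Recovery: take v^n := J^n_k v with k = k(n) -> oo slowly. *)

Set Implicit Arguments. Unset Strict Implicit. Unset Printing Implicit Defensive.
Import Order.TTheory GRing.Theory Num.Theory.
Import numFieldNormedType.Exports.
Local Open Scope classical_set_scope.
Local Open Scope ring_scope.

(** The obstacle is that [phin n] is nonlinear: weak convergence of [un] says nothing about
    [phin n (un n x)] at a point x. Resolvents are therefore evaluated only at a fixed function,
    where pointwise limits and a quadratic dominating function are available, while [un] meets them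
    only linearly, inside an inner product. The resolvent is described by a variational inequality
    because that inequality can be integrated as it stands: no subdifferential of an integral
    functional has to be identified. No measurable selection is made either, since resolvents are
    continuous maps of H and composition with them preserves strong measurability. Nonzero constants
    are integrable only when [mu] is finite; this is the origin of the dichotomy
    [C = 0 \/ (mu setT < +oo)%E] that accompanies every bound at 0. The resolvent serves a second
    time in the Riesz representation, which is obtained from the indicator of a hyperplane. *)

Section extended_limits.
Context {R : realType}.
Implicit Types (u : (\bar R)^nat) (l : \bar R).
Local Open Scope ereal_scope.

Lemma limn_esup_lt_near u l :
  limn_esup u < l -> \forall n \near \oo, u n < l.
Proof.
rewrite /limn_esup /limf_esup => /ereal_inf_lt[_ [V V_oo <-]] supVl.
near=> n; apply: le_lt_trans supVl; apply: ereal_sup_ubound; exists n => //.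
by near: n.
Unshelve. all: by end_near. Qed.

Lemma limn_esup_le u l :
  (forall a : R, l < a%:E -> \forall n \near \oo, u n <= a%:E) ->
  limn_esup u <= l.
Proof.
move=> ul; have esup_le (a : R) : l < a%:E -> limn_esup u <= a%:E.
  move=> /ul uV; apply: le_trans (ereal_inf_lbound _) _.
    by exists [set n | u n <= a%:E].
  by apply: ge_ereal_sup => _ [n un <-].
case: l {ul} esup_le => [l| |] esup_le.
- by apply/lee_addgt0Pr => e e0; rewrite -EFinD esup_le// lte_fin ltrDl.
- by rewrite leey.
- rewrite leeNy_eq; move: esup_le.
  case: (limn_esup u) => // [r /(_ (r - 1)%R (ltNyr _))|/(_ 0%R (ltNyr _))//].
  by rewrite lee_fin; lra.
Qed.

Lemma limn_einf_gt_near u l :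
  l < limn_einf u -> \forall n \near \oo, l < u n.
Proof.
rewrite /limn_einf lteNr => /limn_esup_lt_near.
by apply: filterS => n; rewrite lteN2.
Qed.

Lemma limn_einf_ge u l :
  (forall a : R, a%:E < l -> \forall n \near \oo, a%:E <= u n) ->
  l <= limn_einf u.
Proof.
move=> ul; rewrite /limn_einf leeNr; apply: limn_esup_le => a.
rewrite lteNl -EFinN => /ul; apply: filterS => n.
by rewrite EFinN leeNl.
Qed.

End extended_limits.

(** [kappa n] is the largest k <= n whose threshold [N k] is at most n. Each k becomes eligible from
    some n on, which drives [kappa] to infinity, and an attained maximum is itself eligible. The
    value 0 of an empty maximum does no harm: past the threshold for k, the index k itself is
    eligible. *)
Lemma near_diagonal (P : nat -> nat -> Prop) :
  (forall k, \forall n \near \oo, P k n) ->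
  exists kappa : nat -> nat, forall k,
    \forall n \near \oo, (k <= kappa n)%N /\ P (kappa n) n.
Proof.
move=> /= hP.
have [N PN] : {N : nat -> nat & forall k n, (N k <= n)%N -> P k n}.
  by apply: (@choice _ _ (fun k N => forall n, (N <= n)%N -> P k n)) => k;
     have [N _ PN] := hP k; exists N => n Nn; exact: PN.
pose ok n k := (N k <= n)%N.
exists (fun n => \max_(k < n.+1 | ok n k) k)%N => k.
exists (maxn k (\max_(j < k.+1) N j)) => //= n; rewrite /= geq_max => /andP[kn Nkn].
have Nk : ok n k.
  by apply: leq_trans Nkn; rewrite (@leq_bigmax _ (fun j : 'I_k.+1 => N j) ord_max).
split.
  by rewrite (@leq_bigmax_cond _ _ (fun j : 'I_n.+1 => nat_of_ord j)
    (Ordinal (kn : (k < n.+1)%N))).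
have [|j okj ->] := @eq_bigmax_cond _ (fun j : 'I_n.+1 => ok n j)
  (fun j : 'I_n.+1 => nat_of_ord j).
  by apply/card_gt0P; exists (Ordinal (kn : (k < n.+1)%N)).
exact: PN.
Qed.

(** * Inner product identities and the Cauchy-Schwarz inequality *)

Section inner_product.
Context {R : realType} {H : normedModType R} {ip : H -> H -> R}.
Hypothesis ipP : is_inner_product ip.
Implicit Types x y z w : H.

Lemma ipC x y : ip x y = ip y x. Proof. by case: ipP. Qed.

Lemma ipxx x : ip x x = `|x| ^+ 2. Proof. by case: ipP. Qed.

Lemma ip0l y : ip 0 y = 0.
Proof.
have [_ lin _] := ipP; have := lin 1 0 0 y.
by rewrite scale1r addr0 mul1r => /eqP; rewrite -subr_eq0 opprD addNKr oppr_eq0 => /eqP.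
Qed.

Lemma ipDl x y z : ip (x + y) z = ip x z + ip y z.
Proof. by have [_ lin _] := ipP; rewrite -[x in LHS]scale1r lin mul1r. Qed.

Lemma ipZl a x z : ip (a *: x) z = a * ip x z.
Proof. by have [_ lin _] := ipP; rewrite -[_ *: _]addr0 lin ip0l addr0. Qed.

Lemma ipNl x z : ip (- x) z = - ip x z.
Proof. by rewrite -scaleN1r ipZl mulN1r. Qed.

Lemma ipBl x y z : ip (x - y) z = ip x z - ip y z.
Proof. by rewrite ipDl ipNl. Qed.

Lemma ipDr x y z : ip z (x + y) = ip z x + ip z y.
Proof. by rewrite ipC ipDl !(ipC z). Qed.

Lemma ipZr a x z : ip z (a *: x) = a * ip z x.
Proof. by rewrite ipC ipZl ipC. Qed.

Lemma ipNr x z : ip z (- x) = - ip z x.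
Proof. by rewrite ipC ipNl ipC. Qed.

Lemma ip0r y : ip y 0 = 0. Proof. by rewrite ipC ip0l. Qed.

Definition ipE := (ipDl, ipDr, ipNl, ipNr, ipZl, ipZr).

Lemma ip_le_norm x y : `|ip x y| <= `|x| * `|y|.
Proof.
wlog ip_ge0 : x / 0 <= ip x y.
  move=> hw; have [|/ltW ip0] := leP 0 (ip x y); first exact: hw.
  by rewrite -[`|ip x y|]normrN -ipNl -[`|x|]normrN; apply: hw; rewrite ipNl oppr_ge0.
rewrite ger0_norm//.
have [->|x0] := eqVneq x 0; first by rewrite ip0l normr0 mul0r.
have [->|y0] := eqVneq y 0; first by rewrite ip0r normr0 mulr0.
(* This square expands to 2|x||y|(|x||y| - <x,y>), and the factor |x||y| is positive. *)
have := ipxx (`|y| *: x - `|x| *: y).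
rewrite !ipE (ipC y x) !ipxx => nE.
have xy0 : 0 < `|x| * `|y| by rewrite mulr_gt0// normr_gt0.
have := sqr_ge0 `| `|y| *: x - `|x| *: y |; rewrite -nE => h.
rewrite -(ler_pM2l xy0); nra.
Qed.

Lemma ip_le_sqr x y : `|ip x y| <= `|x| ^+ 2 + `|y| ^+ 2.
Proof.
apply: le_trans (ip_le_norm x y) _.
by have := sqr_ge0 (`|x| - `|y|); have := sqr_ge0 `|x|; have := sqr_ge0 `|y|; nra.
Qed.

Lemma cvg_ipl w : continuous (ip^~ w).
Proof.
move=> x; apply/cvgrPdist_lt => e e0.
near=> y; rewrite -ipBl; apply: le_lt_trans (ip_le_norm _ _) _.
apply: (@le_lt_trans _ _ (`|x - y| * (`|w| + 1))).
  by rewrite ler_wpM2l// lerDl.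
rewrite -ltr_pdivlMr ?ltr_wpDl//.
near: y; apply: (cvgr_dist_lt id x cvg_id).
by rewrite divr_gt0// ltr_wpDl.
Unshelve. all: by end_near. Qed.

Lemma sqr_normD_le x y : `|x + y| ^+ 2 <= 2 * (`|x| ^+ 2 + `|y| ^+ 2).
Proof.
have := sqr_ge0 `|x - y|; rewrite -!ipxx !ipE (ipC y x); lra.
Qed.

End inner_product.

Lemma lt_EFin_between {R : realType} (r : R) (x : \bar R) :
  (r%:E < x)%E -> exists2 a : R, r < a & (a%:E < x)%E.
Proof.
case: x => [x| |//]; last by exists (r + 1); rewrite ?ltrDl ?ltry.
by rewrite lte_fin => rx; exists ((r + x) / 2); rewrite ?lte_fin; lra.
Qed.

Section lower_semicontinuity.
Context {R : realType} {X : topologicalType}.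
Implicit Types f : X -> \bar R.

Lemma lsc_near_gt f (T : Type) (F : set_system T) {FF : Filter F}
    (z : T -> X) p (a : R) :
  lower_semicontinuous f -> z t @[t --> F] --> p -> (a%:E < f p)%E ->
  \forall t \near F, (a%:E < f (z t))%E.
Proof.
by move=> lscf zp /lscf[V pV Vf]; near=> t; apply: Vf; near: t; exact: zp.
Unshelve. all: by end_near. Qed.

Lemma lsc_le_cvg f (T : Type) (F : set_system T) {FF : ProperFilter F}
    (z : T -> X) p (r : T -> R) (l : R) :
  lower_semicontinuous f -> z t @[t --> F] --> p -> r t @[t --> F] --> l ->
  (\forall t \near F, (f (z t) <= (r t)%:E)%E) -> (f p <= l%:E)%E.
Proof.
move=> lscf zp rl fzr; rewrite leNgt; apply/negP => /lt_EFin_between[a la afp].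
have : \forall t \near F, False; last by move=> /filter_ex[].
near=> t; have : (a%:E < (r t)%:E)%E.
  apply: (@lt_le_trans _ _ (f (z t))); last by near: t.
  by near: t; exact: lsc_near_gt lscf zp afp.
rewrite lte_fin ltNge => /negP; apply.
by near: t; exact: (cvgr_le l).
Unshelve. all: by end_near. Qed.

End lower_semicontinuity.

Lemma cvg_of_near_dist {R : realType} {H : completeNormedModType R} (u : nat -> H) :
  (forall e : R, 0 < e -> exists x, \forall n \near \oo, `|x - u n| < e) ->
  cvg (u @ \oo).
Proof.
move=> uC; apply: cauchy_cvg; apply: cauchy_exP => e /uC[x ux].
by exists x; near=> n => /=; rewrite -ball_normE /=; near: n.
Unshelve. all: by end_near. Qed.

(** * Resolvents of convex functions *)

Section resolvent.
Context {R : realType} {H : completeNormedModType R} {ip : H -> H -> R}.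
Hypothesis ipP : is_inner_product ip.
Implicit Types (f : H -> \bar R) (x y z w p : H) (k : R).

Local Notation ipE := (ipE ipP).
Local Notation ipxx := (ipxx ipP).
Local Notation ipC := (ipC ipP).

Definition proper_lsc_convex f :=
  [/\ nonneg_fun f, proper_fun f, lower_semicontinuous f & convex_fun f].

Lemma cvg_sqr_norm (u : nat -> H) x : u @ \oo --> x ->
  `|u n| ^+ 2 @[n --> \oo] --> `|x| ^+ 2.
Proof. by move=> ux; rewrite !expr2; apply: cvgM; exact: cvg_norm. Qed.

(** A minimising sequence is Cauchy. At the midpoint of two of its terms convexity of f and the
    parallelogram identity save k/8 times the squared distance of the terms; since the infimum
    cannot be undercut, this saving is at most the mean excess, whence the factor 4 / k. Lower
    semicontinuity then handles the limit. *)
Lemma strongly_convex_min f k y : proper_lsc_convex f -> 0 < k ->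
  exists p, forall w,
    (f p + (k / 2 * `|p - y| ^+ 2)%:E <= f w + (k / 2 * `|w - y| ^+ 2)%:E)%E.
Proof.
move=> [f0 [x0 fx0] lscf convf] k0.
pose q z := k / 2 * `|z - y| ^+ 2.
have q0 z : 0 <= q z by rewrite /q mulr_ge0// ?sqr_ge0// divr_ge0// ltW.
pose S := [set (f z + (q z)%:E)%E | z in setT].
have S0 : (0 <= ereal_inf S)%E.
  by apply: le_ereal_inf_tmp => _ [z _ <-]; rewrite adde_ge0// lee_fin.
have Sfin : ereal_inf S \is a fin_num.
  rewrite ge0_fin_numE//; apply: (@le_lt_trans _ _ (f x0 + (q x0)%:E)%E).
    by apply: ereal_inf_lbound; exists x0.
  by rewrite lte_add_pinfty// ltry.
pose m := fine (ereal_inf S).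
have mE : ereal_inf S = m%:E by rewrite fineK.
have m_le z : (m%:E <= f z + (q z)%:E)%E.
  by rewrite -mE; apply: ereal_inf_lbound; exists z.
have /choice[z zP] n : exists z, (f z + (q z)%:E < (m + n.+1%:R^-1)%:E)%E.
  have n0 : (0 : R) < n.+1%:R^-1 by rewrite invr_gt0.
  have [_ [z _ <-]] := lb_ereal_inf_adherent n0 Sfin.
  by rewrite mE -EFinD; exists z.
have fz n : f (z n) \is a fin_num.
  rewrite ge0_fin_numE//; have := zP n.
  by case: (f (z n)) (f0 (z n)) => // r _; rewrite ltry.
have zdist i j : `|z i - z j| ^+ 2 <= 4 / k * (i.+1%:R^-1 + j.+1%:R^-1).
  have := zP i; have := zP j.
  have := convf (z i) (z j) (1 / 2); rewrite -(fineK (fz i)) -(fineK (fz j)).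
  set fi := fine _; set fj := fine _ => /(_ ltac:(lra)) cv.
  rewrite -!EFinD !lte_fin => zj zi.
  have mid := m_le ((1 / 2) *: z i + (1 - 1 / 2) *: z j).
  have := le_trans mid (leeD2r _ cv); rewrite -!EFinM -!EFinD lee_fin.
  move: zi zj; rewrite /q -!ipxx !ipE.
  rewrite !(ipC y) (ipC (z j) (z i)) => zi zj zm.
  rewrite [4 / k]mulrC -mulrA mulrC ler_pdivlMr//.
  by move: (i.+1%:R^-1) (j.+1%:R^-1) zi zj => a b zi zj; lra.
have zcvg : cvg (z @ \oo).
  apply: cvg_of_near_dist => e e0.
  have d0 : 0 < e ^+ 2 * k / 8 by rewrite divr_gt0// mulr_gt0// exprn_gt0.
  have [N _ Ne] := near_infty_natSinv_lt (PosNum d0).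
  exists (z N); exists N => // n /= Nn.
  rewrite -ltr_sqr ?nnegrE// 1?ltW//; apply: le_lt_trans (zdist _ _) _.
  have := Ne N (leqnn N); have := Ne n Nn => /=.
  set a := n.+1%:R^-1; set b := N.+1%:R^-1 => ha hb.
  rewrite mulrAC ltr_pdivrMr//; lra.
exists (lim (z @ \oo)) => w; set p := lim _.
have zp : z @ \oo --> p by [].
apply: le_trans (m_le w).
have qz : q (z n) @[n --> \oo] --> q p.
  apply: cvgM; first exact: cvg_cst.
  by apply: cvg_sqr_norm; apply: cvgB => //; exact: cvg_cst.
suff : (f p <= (m + 0 - q p)%:E)%E.
  by rewrite addr0 EFinB leeBrDr.
apply: (lsc_le_cvg lscf zp (r := fun n => m + n.+1%:R^-1 - q (z n))).
  apply: cvgB qz; apply: cvgD; first exact: cvg_cst.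
  exact: cvg_harmonic.
by near=> n; rewrite EFinB leeBrDr// ltW.
Unshelve. all: by end_near. Qed.

(** Equivalent to k(y - p) being a subgradient of f at p, that is p = (I + k^-1 df)^-1 y. Here k is
    the reciprocal of the usual step length, so large k means a p close to the domain point nearest
    y. *)
Definition is_resolvent f k y p :=
  forall w, (f p + (k * ip (y - p) (w - p))%:E <= f w)%E.

(** The minimiser p is compared with t w + (1 - t) p. After division by t the quadratic term leaves
    an error t k/2 |w - p|^2, which vanishes as t tends to 0. *)
Lemma resolvent_exists f k y : proper_lsc_convex f -> 0 < k ->
  exists p, is_resolvent f k y p.
Proof.
move=> gf k0; have [p pmin] := strongly_convex_min y gf k0.
case: gf => f0 [x0 fx0] lscf convf.
exists p => w; case: (ltP (f w) +oo%E) => [fw|]; last first.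
  by rewrite leye_eq => /eqP ->; rewrite leey.
have fwE : f w \is a fin_num by rewrite ge0_fin_numE.
have fpE : f p \is a fin_num.
  rewrite ge0_fin_numE//; have := pmin w; rewrite -(fineK fwE) -EFinD.
  by case: (f p) (f0 p) => // r _; rewrite ltry.
have := fineK fwE; have := fineK fpE.
set a := fine (f p); set b := fine (f w) => fpa fwb.
rewrite -fpa -fwb -EFinD lee_fin.
have tP t : 0 < t <= 1 ->
    a + k * ip (y - p) (w - p) <= b + t * (k / 2 * `|w - p| ^+ 2).
  move=> t01; have := convf w p t; have := pmin (t *: w + (1 - t) *: p).
  rewrite -fpa -fwb -!EFinM -!EFinD => pt /(_ ltac:(lra)) cv.
  have := le_trans pt (leeD2r _ cv); rewrite -EFinD lee_fin.
  rewrite -!ipxx !ipE; move: t01 => /andP[t0 _].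
  rewrite !(ipC y) (ipC p w) => h.
  rewrite -(ler_pM2l t0); lra.
apply/ler_addgt0Pr => e e0.
pose c := k / 2 * `|w - p| ^+ 2.
have c0 : 0 <= c by rewrite mulr_ge0// ?divr_ge0// ltW.
have c1 : 0 < c + e + 1 by lra.
(* This t lies in ]0, 1] and satisfies t c <= e, also when c = 0. *)
apply: (le_trans (tP (e / (c + e + 1)) _)).
  by rewrite divr_gt0//= ler_pdivrMr// mul1r; lra.
rewrite lerD2l -/c mulrAC ler_pdivrMr//; nra.
Qed.

End resolvent.

Arguments is_resolvent {R H} ip f k y p.

Section resolvent_theory.
Context {R : realType} {H : completeNormedModType R} {ip : H -> H -> R}.
Hypothesis ipP : is_inner_product ip.
Implicit Types (f : H -> \bar R) (x y z w p : H) (k : R).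

Local Notation ipE := (ipE ipP).
Local Notation ipxx := (ipxx ipP).
Local Notation ipC := (ipC ipP).

Lemma is_resolvent_fin f k y p : nonneg_fun f -> proper_fun f ->
  is_resolvent ip f k y p -> f p \is a fin_num.
Proof.
move=> f0 [w fw] /(_ w); rewrite ge0_fin_numE//.
by case: (f p) (f0 p) => // [r _|_ /le_lt_trans /(_ fw)//]; rewrite ltry.
Qed.

(** Testing each inequality at the other point and adding cancels the values of f and leaves |p -
    q|^2 <= <y - z, p - q>; Cauchy-Schwarz concludes. *)
Lemma is_resolvent_nonexpansive f k y z p q : nonneg_fun f -> proper_fun f ->
  0 < k -> is_resolvent ip f k y p -> is_resolvent ip f k z q ->
  `|p - q| <= `|y - z|.
Proof.
move=> f0 pf k0 yp zq.
have := yp q; have := zq p.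
rewrite -(fineK (is_resolvent_fin f0 pf yp)) -(fineK (is_resolvent_fin f0 pf zq)).
set a := fine _; set b := fine _; rewrite -!EFinD !lee_fin => hb ha.
have pq : `|p - q| ^+ 2 <= ip (y - z) (p - q).
  rewrite -ipxx -(ler_pM2l k0); move: ha hb.
  rewrite !ipE !(ipC q) !(ipC p) => ha hb; lra.
have := le_trans pq (le_trans (ler_norm _) (ip_le_norm ipP _ _)).
have [->|pq0] := eqVneq (p - q) 0; first by rewrite normr0.
by rewrite expr2 ler_pM2r// normr_gt0.
Qed.

Definition resolvent f k y : H := xget 0 (is_resolvent ip f k y).

(** The value at y of the affine minorant z |-> f(J) + k<y - J, z - J> that touches f at J = J_k y.
    This is why the weight is k, not the k/2 of the Moreau envelope: the inequality against f has no
    quadratic remainder. *)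
Definition prox_energy f k y : R :=
  fine (f (resolvent f k y)) + k * `|y - resolvent f k y| ^+ 2.

Section fixed_function.
Variables (f : H -> \bar R) (k : R).
Hypotheses (gf : proper_lsc_convex f) (k0 : 0 < k).
Local Notation J := (resolvent f k).

Lemma resolventP y : is_resolvent ip f k y (J y).
Proof. by have [p yp] := resolvent_exists ipP y gf k0; exact: xgetI yp. Qed.

Lemma resolvent_fin y : f (J y) \is a fin_num.
Proof. by have [f0 pf _ _] := gf; exact: is_resolvent_fin (resolventP y). Qed.

Lemma resolvent_nonexpansive y z : `|J y - J z| <= `|y - z|.
Proof.
by have [f0 pf _ _] := gf;
   exact: is_resolvent_nonexpansive (resolventP y) (resolventP z).
Qed.

Lemma continuous_resolvent : continuous J.
Proof.
move=> x; apply/cvgrPdist_lt => e e0; near=> y.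
apply: le_lt_trans (resolvent_nonexpansive _ _) _.
by near: y; apply: (cvgr_dist_lt id x cvg_id).
Unshelve. all: by end_near. Qed.

Lemma resolvent_unique y p : is_resolvent ip f k y p -> J y = p.
Proof.
move=> yp; have [f0 pf _ _] := gf.
have := is_resolvent_nonexpansive f0 pf k0 (resolventP y) yp.
by rewrite subrr normr0 normr_le0 subr_eq0 => /eqP.
Qed.

Lemma resolvent_ineq y w :
  ((fine (f (J y)) + k * ip (y - J y) (w - J y))%:E <= f w)%E.
Proof. by rewrite EFinD fineK ?resolvent_fin//; exact: resolventP. Qed.

Lemma prox_energy_ineq y w :
  ((prox_energy f k y + k * ip (y - J y) (w - y))%:E <= f w)%E.
Proof.
apply: le_trans (resolvent_ineq y w); rewrite lee_fin /prox_energy -ipxx !ipE.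
rewrite !(ipC (J y)); lra.
Qed.

Lemma prox_energy_le y : ((prox_energy f k y)%:E <= f y)%E.
Proof. by have := prox_energy_ineq y y; rewrite subrr (ip0r ipP) mulr0 addr0. Qed.

Lemma fine_resolvent_ge0 y : 0 <= fine (f (J y)).
Proof. by apply: fine_ge0; case: gf => /(_ (J y)). Qed.

Lemma prox_energy_ge0 y : 0 <= prox_energy f k y.
Proof. by rewrite addr_ge0 ?fine_resolvent_ge0// mulr_ge0// ltW. Qed.

Lemma resolvent0 : f 0 = 0%E -> J 0 = 0.
Proof.
move=> f00; apply: resolvent_unique => w.
by rewrite f00 subr0 (ip0l ipP) mulr0 add0e; case: gf => /(_ w).
Qed.

Lemma resolvent_norm_le C y : `|J 0| <= C -> `|J y| <= `|y| + C.
Proof.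
move=> JC; rewrite -[J y](subrK (J 0)); apply: le_trans (ler_normD _ _) _.
by rewrite lerD//; have := resolvent_nonexpansive y 0; rewrite subr0.
Qed.

(** Provides a dominating function that depends on f only through the bound C at 0, hence one common
    to all [phin n]. The minorant is tested at w = J 0, and (2|y| + C)(|y| + C) <= 4(|y|^2 +
    C^2). *)
Lemma prox_energy_bound C y : `|J 0| <= C -> fine (f (J 0)) <= C ->
  prox_energy f k y <= C + k * (4 * (`|y| ^+ 2 + C ^+ 2)).
Proof.
move=> JC fC; have := prox_energy_ineq y (J 0).
rewrite -(fineK (resolvent_fin 0)) lee_fin => pe.
have Jy := resolvent_norm_le y JC.
have : - ip (y - J y) (J 0 - y) <= `|y - J y| * `|J 0 - y|.
  by apply: le_trans (ip_le_norm ipP _ _); rewrite -normrN ler_norm.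
have n1 : `|y - J y| <= 2 * `|y| + C.
  by apply: le_trans (ler_normB _ _) _; lra.
have n2 : `|J 0 - y| <= C + `|y|.
  by apply: le_trans (ler_normB _ _) _; lra.
have := ler_pM (normr_ge0 _) (normr_ge0 _) n1 n2.
move: (ip _ _) (`|_ - _| * `|_ - _|) pe => a b pe ? ?.
have C0 : 0 <= C by exact: le_trans JC.
have : - a <= 4 * (`|y| ^+ 2 + C ^+ 2).
  have := sqr_ge0 (`|y| - C); have := sqr_ge0 `|y|; have := sqr_ge0 C; nra.
rewrite -(ler_pM2l k0); lra.
Qed.

End fixed_function.

(** Convergence of J_k y to y is not at hand when y is outside the closed domain, so two cases are
    distinguished for a < f y: either J_k y lies in a ball around y on which f > a, or |y - J_k y|
    >= r and the penalty alone exceeds a once k r^2 > |a|. *)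
Lemma prox_energy_liminf f y : proper_lsc_convex f ->
  (f y <= limn_einf (fun n => (prox_energy f n.+1%:R y)%:E))%E.
Proof.
move=> gf; apply: limn_einf_ge => a afy.
have [_ _ lscf _] := gf.
have [V + Va] := lscf y a afy; rewrite -nbhs_ballE => -[r /= r0 rV].
have r20 : 0 < r ^+ 2 by rewrite exprn_gt0.
exists (Num.trunc (`|a| / r ^+ 2)).+1 => //= n /= an.
rewrite lee_fin; have n0 : (0 : R) < n.+1%:R by [].
have [yJ|yJ] := ltP `|y - resolvent f n.+1%:R y| r.
  have := Va (resolvent f n.+1%:R y).
  rewrite -(fineK (resolvent_fin gf n0 y)) lte_fin => /(_ _)/ltW aJ.
  apply: le_trans (aJ _) _; first by apply: rV; rewrite -ball_normE.
  by rewrite lerDl mulr_ge0 ?exprn_ge0.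
apply: (@le_trans _ _ (n.+1%:R * r ^+ 2)).
  apply: le_trans (ler_norm a) _; rewrite -ler_pdivrMr// ltW//.
  apply: lt_le_trans (truncnS_gt _) _.
  by rewrite ler_nat (leq_trans an).
apply: (@le_trans _ _ (n.+1%:R * `|y - resolvent f n.+1%:R y| ^+ 2)).
  by rewrite ler_pM2l// ler_sqr ?nnegrE// ltW.
by rewrite lerDr; exact: fine_resolvent_ge0.
Qed.

(** The resolvent of the indicator of {l = 1} at 0 is the point p of that hyperplane nearest 0.
    Since p + z and p - z are admissible whenever l z = 0, p is orthogonal to the kernel, and w - (l
    w) p lies in the kernel. *)
Lemma riesz_representation (l : H -> R) (M : R) :
  (forall a x y, l (a *: x + y) = a * l x + l y) ->
  (forall x, `|l x| <= M * `|x|) ->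
  exists x, forall w, l w = ip x w.
Proof.
move=> lin bnd.
have l0 : l 0 = 0.
  by apply/eqP; rewrite -normr_le0 (le_trans (bnd 0))// normr0 mulr0.
have lD x y : l (x + y) = l x + l y by rewrite -[x in LHS]scale1r lin mul1r.
have lZ a x : l (a *: x) = a * l x by rewrite -[_ *: _]addr0 lin l0 addr0.
have [[v lv]|/forallNP lnul] := pselect (exists v, l v != 0); last first.
  by exists 0 => w; rewrite (ip0l ipP); apply/eqP/negP => /negP; exact: lnul.
pose f z : \bar R := if l z == 1 then 0%E else +oo%E.
have gf : proper_lsc_convex f.
  split.
  - by move=> z; rewrite /f; case: ifP; rewrite ?leey.
  - by exists ((l v)^-1 *: v); rewrite /f lZ mulVf// eqxx.
  - move=> x a; rewrite /f; case: ifPn => [_ a0|lx _].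
      by exists setT; [exact: filterT|move=> z _; case: ifP; rewrite ?ltry].
    exists [set z | l z != 1]; last by move=> z /= /negPf ->; rewrite ltry.
    (* Within this radius [l] cannot reach 1; [|M| + 1] keeps the divisor positive whatever M is. *)
    rewrite -nbhs_ballE; exists (`|l x - 1| / (`|M| + 1)).
      by rewrite /= divr_gt0 ?normr_gt0 ?subr_eq0// ltr_wpDl.
    move=> z; rewrite -ball_normE /= ltr_pdivlMr ?ltr_wpDl// => xz.
    apply/eqP => lz; move: xz; rewrite -[X in _ < `|_ - X|]lz ltNge => /negP; apply.
    rewrite -mulN1r -lZ -lD scaleN1r; apply: le_trans (bnd _) _.
    by rewrite mulrC ler_wpM2l// (le_trans (ler_norm M))// lerDl.
  - move=> x y t t01; rewrite {2 3}/f.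
    case: ifPn => [/eqP lx|lx]; case: ifPn => [/eqP ly|ly].
    + by rewrite !mule0 adde0 /f lD !lZ lx ly !mulr1 subrKC eqxx.
    + rewrite mule0 add0e; have [->|t1] := eqVneq t 1.
        by rewrite subrr scale0r addr0 scale1r mul0e /f lx eqxx.
      by rewrite gt0_muley ?leey// lte_fin subr_gt0 lt_neqAle t1; case/andP: t01.
    + rewrite mule0 adde0; have [->|t0] := eqVneq t 0.
        by rewrite subr0 scale0r add0r scale1r mul0e /f ly eqxx.
      by rewrite gt0_muley ?leey// lte_fin lt_neqAle eq_sym t0; case/andP: t01.
    + have [->|t0] := eqVneq t 0; first by rewrite mul0e add0e subr0 mul1e leey.
      rewrite gt0_muley; last by rewrite lte_fin lt_neqAle eq_sym t0; case/andP: t01.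
      rewrite addye ?leey// gt_eqF// (@lt_le_trans _ _ 0%E)// ?ltNy0//.
      by rewrite mule_ge0 ?leey// lee_fin subr_ge0; case/andP: t01.
have [p pP] := resolvent_exists ipP 0 gf ltr01.
have lp : l p = 1.
  have [f0 pf _ _] := gf; have := is_resolvent_fin f0 pf pP.
  by rewrite /f; case: ifPn => // /eqP.
have orth z : l z = 0 -> ip p z = 0.
  move=> lz; have := pP (p + z); have := pP (p - z).
  have lNz : l (- z) = 0 by rewrite -scaleN1r lZ lz mulr0.
  by rewrite /f !lD lNz lz lp !addr0 eqxx !add0e !lee_fin sub0r !ipE; lra.
have p0 : ip p p != 0.
  apply/eqP => pp; move: lp; have -> : p = 0.
    by apply/eqP; rewrite -normr_eq0 -sqrf_eq0 -ipxx pp.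
  by rewrite l0 => /esym/eqP; rewrite oner_eq0.
exists ((ip p p)^-1 *: p) => w.
have := orth (w + (- l w) *: p); rewrite lD lZ lp mulr1 subrr => /(_ erefl).
rewrite !ipE => /eqP; rewrite mulNr subr_eq0 => /eqP ->.
by rewrite mulrCA mulVf// mulr1.
Qed.

End resolvent_theory.

Arguments resolvent {R H} ip f k y.
Arguments prox_energy {R H} ip f k y.

(** * Weak sequential compactness *)

Lemma separable_dense_seq {R : realType} {H : normedModType R} :
  separable H -> exists d : nat -> H, forall x (e : R), 0 < e ->
    exists i, `|x - d i| < e.
Proof.
move=> [D [/countable_injP[f finj] Dd]].
exists (fun n => xget 0 [set x | D x /\ f x = n]) => x e e0.
have : closure D x by rewrite Dd.
move=> /(_ (ball x e) (nbhsx_ballx _ _ e0)) [y [Dy]].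
rewrite -ball_normE /= => xy; exists (f y).
case: xgetP => [z _ [Dz fz]|/(_ y)/=]; last by move=> /(_ (conj Dy erefl)).
by rewrite (finj z y) ?inE.
Qed.

(** A cluster point exists by compactness of [-M, M], and for an ultrafilter a cluster point is a
    limit. One ultrafilter thus serves all test vectors at once. *)
Lemma bounded_ultra_cvg {R : realType} (T : Type) (G : set_system T) (u : T -> R)
    (M : R) : UltraFilter G -> (\forall t \near G, `|u t| <= M) ->
  exists2 l : R, u t @[t --> G] --> l & `|l| <= M.
Proof.
move=> GU uM; have GP := ultra_proper (F := G).
have [|l [+ lcl]] := @segment_compact R (- M) M (u @ G) _.
  by apply: filterS uM => t /=; rewrite in_itv /= ler_norml.
rewrite /= in_itv /= -ler_norml => lM; exists l => // B lB.
have [//|GC] := in_ultra_setVsetC (u @^-1` B) GU.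
by have [y []] := lcl (~` B) B GC lB.
Qed.

Section weak_compactness.
Context {R : realType} {H : completeNormedModType R} {ip : H -> H -> R}.
Hypotheses (ipP : is_inner_product ip) (sepH : separable H).

(** The subsequence keeps its original indices, and the gaps are filled with the weak limit y:
    Mosco's liminf condition pairs the n-th vector with [phin n], so indices must not be
    renumbered. *)
Lemma weak_sequential_compactness (x : nat -> H) (M : R) (P : set nat) :
  (forall n, P n -> `|x n| <= M) ->
  (forall N, exists2 n, (N <= n)%N & P n) ->
  exists (y : H) (Q : set nat),
    [/\ Q `<=` P, forall N, exists2 n, (N <= n)%N & Q n &
        weak_cvg ip (fun n => if n \in Q then x n else y) y].
Proof.
move=> xM Pinf.
have FP : ProperFilter (within P \oo).
  apply: Build_ProperFilter_ex => A [N _ NA].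
  by have [n Nn Pn] := Pinf N; exists n; exact: NA.
have [G [GU FG]] := ultraFilterLemma FP.
have GP := ultra_proper (F := G).
have GPn : \forall n \near G, P n by apply: FG; exact: nearW.
have Gge k : \forall n \near G, (k <= n)%N.
  by apply: FG; exists k => // n /= kn _.
have /choice[l lP] w : exists l : R,
    ip (x n) w @[n --> G] --> l /\ `|l| <= M * `|w|.
  have [|l xl lM] := @bounded_ultra_cvg R nat G (fun n => ip (x n) w) (M * `|w|) GU.
    apply: filterS GPn => n Pn; apply: le_trans (ip_le_norm ipP _ _) _.
    by rewrite ler_wpM2r// xM.
  by exists l.
have [y ly] : exists y, forall w, l w = ip y w.
  (* The limit along the ultrafilter is linear in w and bounded by M|w|, hence represented by a
     vector. *)
  apply: (riesz_representation ipP (M := M)); last by move=> w; case: (lP w).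
  move=> a v w; apply: (norm_cvg_unique (F := ip (x n) (a *: v + w) @[n --> G])).
    by case: (lP (a *: v + w)).
  rewrite /=; under eq_fun do rewrite (ipDr ipP) (ipZr ipP).
  by apply: cvgD; [apply: cvgM; [exact: cvg_cst|case: (lP v)]|case: (lP w)].
have [d dd] := separable_dense_seq sepH.
have dcvg j e : 0 < e -> \forall n \near G, `|ip (x n - y) (d j)| < e.
  move=> e0; have [+ _] := lP (d j) => /cvgr_dist_lt /(_ e e0).
  by apply: filterS => n; rewrite ly distrC (ipBl ipP).
(* From ultrafilter to sequence: [nu k] controls the first k + 1 vectors of a dense sequence up to
   1/(k + 1). Boundedness extends the control to every w. *)
have /choice[nu nuP] k : exists n, [/\ P n, (k <= n)%N &
    forall j, (j <= k)%N -> `|ip (x n - y) (d j)| < k.+1%:R^-1].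
  have : \forall n \near G, [/\ P n, (k <= n)%N &
      forall j : 'I_k.+1, `|ip (x n - y) (d j)| < k.+1%:R^-1].
    near=> n; split; [by near: n|by near: n|].
    by near: n; apply: filter_forall => j; exact: dcvg.
  move=> /filter_ex[n [Pn kn nd]]; exists n; split => // j jk.
  exact: (nd (Ordinal (jk : (j < k.+1)%N))).
pose Q := range nu.
exists y, Q; split.
- by move=> _ [k _ <-]; case: (nuP k).
- by move=> N; exists (nu N); [case: (nuP N)|exists N].
move=> w; apply/cvgrPdist_lt => e e0.
have M0 : 0 <= M by case: (nuP 0%N) => /xM + _ _; exact: le_trans.
pose B := M + `|y| + 1.
have B0 : 0 < B by rewrite ltr_wpDl// addr_ge0.
have eB0 : 0 < e / 2 / B by rewrite !divr_gt0.
have [j wj] := dd w _ eB0.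
have e20 : 0 < e / 2 by rewrite divr_gt0.
have [N1 _ N1e] := near_infty_natSinv_lt (PosNum e20).
(* [nu] need not be monotone, so n is taken beyond all early values of [nu]; then n = [nu k] forces
   k to be late. *)
exists (\max_(k < (maxn N1 j).+1) nu k).+1 => // n /= nmax.
case: ifPn => [|_]; last by rewrite subrr normr0.
rewrite inE => -[k _ nuk].
have kmax : (maxn N1 j < k)%N.
  rewrite ltnNge; apply/negP => km; move: nmax; rewrite -nuk ltnNge => /negP; apply.
  exact: (@leq_bigmax _ (fun i : 'I_(maxn N1 j).+1 => nu i)
    (Ordinal (km : (k < (maxn N1 j).+1)%N))).
have [Pn _ nd] := nuP k; rewrite nuk in Pn nd.
have xy : `|x n - y| < B.
  by apply: le_lt_trans (ler_normB _ _) _; rewrite /B ltr_pwDr// lerD2r xM.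
rewrite distrC -(ipBl ipP) -(subrKC (d j) w) (ipDr ipP).
apply: le_lt_trans (ler_normD _ _) _; rewrite [e]splitr ltrD//.
  apply: lt_trans (nd j _) _; first by rewrite ltnW// (leq_ltn_trans (leq_maxr N1 j)).
  by apply: N1e => /=; rewrite ltnW// (leq_ltn_trans (leq_maxl N1 j)).
apply: le_lt_trans (ip_le_norm ipP _ _) _.
rewrite -[ltRHS](divfK (lt0r_neq0 B0)) mulrC.
by rewrite ltr_pM.
Unshelve. all: by end_near. Qed.

End weak_compactness.

(** * Mosco convergence implies convergence of resolvents and energies *)

Section mosco_resolvent.
Context {R : realType} {H : completeNormedModType R} {ip : H -> H -> R}.
Hypotheses (ipP : is_inner_product ip) (sepH : separable H).
Context {phin : nat -> H -> \bar R} {phi : H -> \bar R}.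
Hypothesis gphin : forall n, proper_lsc_convex (phin n).
Hypothesis gphi : proper_lsc_convex phi.
Hypothesis mosco : Mosco setT (weak_cvg ip) strong_cvg phin phi.

Local Notation ipE := (ipE ipP).
Local Notation ipxx := (ipxx ipP).
Local Notation ipC := (ipC ipP).

Lemma strong_weak_cvg (x : nat -> H) (l : H) :
  x @ \oo --> l -> weak_cvg ip x l.
Proof. by move=> xl w; exact: (continuous_cvg _ (@cvg_ipl R H ip ipP w l) xl). Qed.

Section fixed_parameter.
Variables (k : R) (y : H).
Hypothesis k0 : 0 < k.
Let p := resolvent ip phi k y.
Let pn n := resolvent ip (phin n) k y.
Let an n := fine (phin n (pn n)).

(** A recovery sequence of the limit resolvent p, used as test point in the n-th variational
    inequality. *)
Let recovery : exists2 q : nat -> H, q @ \oo --> p &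
  forall e, 0 < e -> \forall n \near \oo,
    an n + k * ip (y - pn n) (q n - pn n) <= fine (phi p) + e.
Proof.
have [_ /(_ p I)[q [_ qp qlim]]] := mosco; exists q => // e e0.
have : (limn_esup (fun n => phin n (q n)) < (fine (phi p) + e)%:E)%E.
  apply: le_lt_trans qlim _; rewrite -(fineK (resolvent_fin ipP gphi k0 y)).
  by rewrite lte_fin ltrDl.
move=> /limn_esup_lt_near; apply: filterS => n /ltW qn; rewrite -lee_fin.
exact: le_trans (resolvent_ineq ipP (gphin n) k0 _ _) qn.
Qed.

(** With t = |pn n|, the recovery inequality gives t^2 <= t(|y| + B) + D. For t > 1 the right side
    is at most t(|y| + B + D), so t cannot exceed 1 + |y| + B + D. *)
Let bounded : exists M, \forall n \near \oo, `|pn n| <= M.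
Proof.
have [q qp /(_ 1 ltr01) rec] := recovery.
pose B := `|p| + 1; pose D := (fine (phi p) + 1) / k + `|y| * B.
exists (1 + `|y| + B + D); near=> n.
have qB : `|q n| <= B.
  by near: n; apply: (cvgr_norm_le p) => //; rewrite ltrDl.
have a0 : 0 <= an n by exact: fine_resolvent_ge0.
have h : ip (y - pn n) (q n - pn n) <= (fine (phi p) + 1) / k.
  rewrite ler_pdivlMr// mulrC; apply: (@le_trans _ _ (fine (phi p) + 1)) => //.
  by apply: le_trans (_ : _ <= an n + k * ip (y - pn n) (q n - pn n)) _;
    [rewrite lerDr|near: n].
have : `|pn n| ^+ 2 <= `|pn n| * (`|y| + B) + D.
  have e1 : ip y (q n) >= - (`|y| * B).
    have := le_trans (ip_le_norm ipP y (q n)) (ler_wpM2l (normr_ge0 y) qB).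
    by rewrite ler_norml => /andP[].
  have e2 : ip (pn n) (y + q n) <= `|pn n| * (`|y| + B).
    apply: le_trans (ler_norm _) (le_trans (ip_le_norm ipP _ _) _).
    by rewrite ler_wpM2l// (le_trans (ler_normD _ _))// lerD2l.
  move: h e2; rewrite -ipxx /D !ipE !(ipC (pn n)); lra.
have B0 : 0 <= B by rewrite /B addr_ge0.
have D0 : 0 <= D.
  apply: addr_ge0; last by rewrite mulr_ge0.
  apply: divr_ge0; last exact: ltW.
  by apply: addr_ge0 => //; exact: fine_resolvent_ge0.
have y0 := normr_ge0 y.
move=> h2; rewrite leNgt; apply/negP => h3.
have : (`|y| + B + D) * `|pn n| < `|pn n| ^+ 2.
  by rewrite expr2 ltr_pM2r; lra.
by nra.
Unshelve. all: by end_near. Qed.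

(** A weak limit x along bad indices suffices, and x need not be identified with p: Mosco's liminf
    at x, bounded below by the affine minorant of [phi] touching at p, is added to the recovery
    inequality. The sum contains |p - pn|^2, which yields strong convergence. *)
Lemma mosco_resolvent_cvg :
  resolvent ip (phin n) k y @[n --> \oo] --> resolvent ip phi k y.
Proof.
have [M bM] := bounded; have [q qp rec] := recovery.
apply: contrapT => ncvg.
have [e e0 einf] : exists2 e, 0 < e &
    forall N, exists2 n, (N <= n)%N & e <= `|p - pn n|.
  apply: contrapT => ne; apply: ncvg; apply/cvgrPdist_lt => e e0.
  apply: contrapT => nN; apply: ne; exists e => // N.
  apply: contrapT => nn; apply: nN; exists N => // n /= Nn.
  by rewrite ltNge; apply/negP => en; apply: nn; exists n.
pose P := [set n | e <= `|p - pn n| /\ `|pn n| <= M].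
have [N|x [Q [QP Qinf wx]]] :=
    @weak_sequential_compactness _ _ _ ipP sepH pn M P (fun n => @proj2 _ _).
  have [N1 _ N1M] := bM; have [n nN en] := einf (maxn N N1).
  exists n; first exact: leq_trans (leq_maxl _ _) nN.
  by split => //; apply: N1M; exact: leq_trans (leq_maxr _ _) nN.
have [/(_ _ x (fun=> I) I wx) phix _] := mosco.
pose c := fine (phi p) + k * ip (y - p) (x - p).
(* Error budget: |p - pn|^2 >= 8d, against 4d lost in the liminf bound and d each in the recovery
   inequality, in q -> p and in the weak convergence, 7d in all. *)
pose d := e ^+ 2 / 8; have d0 : 0 < d by rewrite divr_gt0// exprn_gt0.
have : ((c - k * (4 * d))%:E < limn_einf (fun n =>
    phin n (if n \in Q then pn n else x)))%E.
  apply: lt_le_trans phix; apply: lt_le_trans (resolvent_ineq ipP gphi k0 y x).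
  by rewrite lte_fin ltrBlDr ltrDl mulr_gt0// mulr_gt0.
move=> /limn_einf_gt_near lo.
have kd0 : 0 < k * d by rewrite mulr_gt0.
have w1 := (cvgrPdist_le _ _).1 (wx (y - p)) d d0.
have Md : 0 < d / (`|y| + `|M| + 1) by rewrite divr_gt0// ltr_wpDl// addr_ge0.
have q1 := (cvgrPdist_lt _ _).1 qp _ Md.
have [N _ NP] : \forall n \near \oo, Q n -> False.
  near=> n => Qn; have [en pM] := QP n Qn.
  have lo' : ((c - k * (4 * d))%:E < phin n (if n \in Q then pn n else x))%E.
    by near: n; exact: lo.
  have w1' : `|ip x (y - p) - ip (if n \in Q then pn n else x) (y - p)| <= d.
    by near: n; exact: w1.
  move: lo' w1'; rewrite mem_set// -(fineK (resolvent_fin ipP (gphin n) k0 y)).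
  rewrite lte_fin -/(an n) ler_norml => lo' /andP[w2 _].
  have rec' : an n + k * ip (y - pn n) (q n - pn n) <= fine (phi p) + k * d.
    by near: n; exact: rec.
  have q2 : - ip (y - pn n) (q n - p) <= d.
    apply: le_trans (ler_norm _) _; rewrite normrN.
    apply: le_trans (ip_le_norm ipP _ _) _.
    have q3 : `|p - q n| < d / (`|y| + `|M| + 1) by near: n; exact: q1.
    rewrite distrC in q3.
    apply: (@le_trans _ _ ((`|y| + `|M| + 1) * (d / (`|y| + `|M| + 1)))).
      apply: ler_pM => //; last exact: ltW.
      apply: le_trans (ler_normB _ _) _; rewrite -addrA lerD2l.
      by apply: le_trans pM (le_trans (ler_norm _) _); rewrite lerDl.
    by rewrite mulrC divfK// lt0r_neq0// ltr_wpDl// addr_ge0.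
  have e3 : 8 * d <= `|p - pn n| ^+ 2.
    by rewrite mulrC divfK// ler_sqr ?nnegrE// ltW.
  have : 8 * d - d - d <= ip (y - pn n) (q n - pn n) - ip (y - p) (p - x).
    move: e3 q2 w2; rewrite -ipxx !ipE.
    by rewrite !(ipC (pn n)) !(ipC p) !(ipC x); lra.
  rewrite -(ler_pM2l k0) => fin; move: lo' rec' fin; rewrite /c.
  by rewrite -[x - p]opprB (ipNr ipP); lra.
by have [n nN Qn] := Qinf N; exact: (NP n nN Qn).
Unshelve. all: by end_near. Qed.

(** The upper half is the recovery inequality, whose inner product now tends to 0; the lower half is
    Mosco's liminf along [pn], which converges strongly and so weakly. *)
Let fine_cvg : an n @[n --> \oo] --> fine (phi p).
Proof.
have pnp := mosco_resolvent_cvg; have [q qp rec] := recovery.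
have ip0 : k * ip (y - pn n) (q n - pn n) @[n --> \oo] --> (0 : R).
  rewrite -[X in _ --> X](mulr0 k); apply: cvgM; first exact: cvg_cst.
  have q0 : q n - pn n @[n --> \oo] --> (0 : H).
    by rewrite -(subrr p); exact: cvgB.
  have : `|y - pn n| * `|q n - pn n| @[n --> \oo] --> `|y - p| * `|0 : H|.
    by apply: cvgM; apply: cvg_norm => //; apply: cvgB => //; exact: cvg_cst.
  rewrite normr0 mulr0 => n0; apply: norm_cvg0.
  apply: (squeeze_cvgr _ (cvg_cst 0) n0).
  by near=> n; rewrite normr_ge0 (ip_le_norm ipP).
apply/cvgrPdist_le => e e0; have e20 : 0 < e / 2 by rewrite divr_gt0.
near=> n; rewrite ler_distlC.
apply/andP; split; last first.
  have r2 : an n + k * ip (y - pn n) (q n - pn n) <= fine (phi p) + e / 2.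
    by near: n; exact: (rec _ e20).
  have : `|0 - k * ip (y - pn n) (q n - pn n)| <= e / 2.
    by near: n; exact: (cvgrPdist_le _ _).1 ip0 _ e20.
  by rewrite ler_norml; lra.
have lo : ((fine (phi p) - e)%:E < phin n (pn n))%E.
  near: n; apply: limn_einf_gt_near.
  have [/(_ pn p (fun=> I) I (strong_weak_cvg pnp)) + _] := mosco.
  apply: lt_le_trans; rewrite -[ltRHS](fineK (resolvent_fin ipP gphi k0 y)).
  by rewrite lte_fin -/p; lra.
by rewrite ltW// -lte_fin (fineK (resolvent_fin ipP (gphin n) k0 y)).
Unshelve. all: by end_near. Qed.

Lemma mosco_prox_energy_cvg :
  prox_energy ip (phin n) k y @[n --> \oo] --> prox_energy ip phi k y.
Proof.
apply: cvgD; first exact: fine_cvg.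
apply: cvgM; first exact: cvg_cst.
apply: cvg_sqr_norm; apply: cvgB; first exact: cvg_cst.
exact: mosco_resolvent_cvg.
Qed.

Lemma mosco_resolvent_bounded :
  exists C : R, forall n, `|pn n| <= C /\ an n <= C.
Proof.
have cvg_bounded (u : nat -> R) (l : R) : u @ \oo --> l ->
    exists C, forall n, u n <= C.
  move=> ul; have : bounded_fun u by apply: cvg_seq_bounded; apply/cvg_ex; exists l.
  case=> M [_ /(_ (M + 1))]; rewrite ltrDl ltr01 => /(_ isT) uM.
  by exists (M + 1) => n; apply: le_trans (ler_norm _) (uM n I).
have [C1 hC1] := cvg_bounded _ _ (cvg_norm mosco_resolvent_cvg).
have [C2 hC2] := cvg_bounded _ _ fine_cvg.
by exists (Num.max C1 C2) => n; rewrite !le_max hC1 hC2 orbT.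
Qed.

End fixed_parameter.

End mosco_resolvent.

Lemma cvg_EFinr {R : realType} {I : Type} {F : set_system I} {FF : Filter F}
    (u : I -> R) (l : R) :
  u i @[i --> F] --> l -> ((u i)%:E @[i --> F] --> l%:E)%E.
Proof. by move=> ul; apply: cvg_EFin => //; exact: nearW. Qed.

Lemma measurable_ltr_set {d : measure_display} {T : measurableType d}
    {R : realType} (f g : T -> R) : measurable_fun setT f ->
  measurable_fun setT g -> measurable [set x | f x < g x].
Proof.
move=> mf mg; have := measurable_fun_ltr mf mg measurableT (Y := [set true]) I.
by rewrite setTI.
Qed.

(** * Strongly measurable functions *)

Section strong_measurability.
Context {R : realType} {H : completeNormedModType R}.
Context {d : measure_display} {T : measurableType d}.
Variable mu : {measure set T -> \bar R}.
Implicit Types (s t u v : T -> H).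

Lemma simple_fun_op2 (op : H -> H -> H) s t : simple_fun s -> simple_fun t ->
  simple_fun (fun x => op (s x) (t x)).
Proof.
move=> [fs ms] [ft mt]; split.
  apply: sub_finite_set (finite_image2 op fs ft).
  by move=> _ [x _ <-]; exists (s x) => //; exists (t x).
move=> y; pose D := [set p : H * H | (range s `*` range t) p /\ op p.1 p.2 = y].
rewrite [X in measurable X](_ : _ =
    \bigcup_(p in D) (s @^-1` [set p.1] `&` t @^-1` [set p.2])).
  apply: fin_bigcup_measurable; last by move=> p _; exact: measurableI.
  by apply: sub_finite_set (finite_setX fs ft) => p [].
apply/seteqP; split=> [x /= xy|x [p [_ py] [/= -> ->]]//].
by exists (s x, t x).
Qed.

Lemma simple_fun_cst (y : H) : simple_fun (fun _ : T => y).
Proof.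
split.
  by apply: (@sub_finite_set _ _ [set y]) => [_ [x _ <-]//|]; exact: finite_set1.
move=> z; have [->|yz] := eqVneq y z.
  by rewrite [X in measurable X](_ : _ = setT)//; apply/seteqP; split.
rewrite [X in measurable X](_ : _ = set0)//; apply/seteqP; split => // x /= /eqP.
by rewrite (negPf yz).
Qed.

Lemma simple_fun_if (A : set T) (y : H) s : measurable A -> simple_fun s ->
  simple_fun (fun x => if x \in A then y else s x).
Proof.
move=> mA [fs ms]; split.
  apply: (@sub_finite_set _ _ (range s `|` [set y])).
    by move=> _ [x _ <-]; case: ifP => _; [right|left; exists x].
  by rewrite finite_setU; split => //; exact: finite_set1.
move=> z; rewrite [X in measurable X](_ : _ =
    (A `&` (fun=> y) @^-1` [set z]) `|` (~` A `&` s @^-1` [set z])).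
  apply: measurableU; apply: measurableI => //; last exact: measurableC.
  by case: (simple_fun_cst y) => _; exact.
apply/seteqP; split=> x /=.
  by case: ifPn; rewrite ?inE ?notin_setE; [left|right].
by move=> [[Ax <-]|[nAx <-]]; [rewrite mem_set|rewrite memNset].
Qed.

Lemma simple_fun_measurable (g : H -> R) s : simple_fun s ->
  measurable_fun setT (fun x => g (s x)).
Proof.
move=> [fs ms] _ B mB; rewrite setTI.
rewrite [X in measurable X](_ : _ =
    \bigcup_(y in [set y | range s y /\ B (g y)]) (s @^-1` [set y])).
  apply: fin_bigcup_measurable; last by move=> p _; exact: ms.
  by apply: sub_finite_set fs => y [].
apply/seteqP; split=> [x /= xB|x [y [_ By] /= -> //]].
by exists (s x) => //; split => //; exists x.
Qed.

Lemma strongly_measurable_comp (g : H -> H) u : continuous g ->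
  strongly_measurable mu u -> strongly_measurable mu (g \o u).
Proof.
move=> cg [s [ss su]]; exists (fun k => g \o s k); split.
  by move=> k; exact: (simple_fun_op2 (fun y _ => g y) (ss k) (ss k)).
apply: filterS su => x su; exact: (continuous_cvg _ (cg (u x)) su).
Qed.

Lemma strongly_measurable_lin (a : R) u v :
  strongly_measurable mu u -> strongly_measurable mu v ->
  strongly_measurable mu (fun x => a *: u x + v x).
Proof.
move=> [s [ss su]] [t [st tv]]; exists (fun k x => a *: s k x + t k x); split.
  by move=> k; exact: (simple_fun_op2 (fun y z => a *: y + z)).
near=> x; apply: cvgD; last by near: x.
by apply: cvgZr; near: x.
Unshelve. all: by end_near. Qed.

Hypothesis cmu : measure_is_complete mu.

(** Completeness of [mu] enters here: g agrees almost everywhere with the measurable upper limit of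
    the f n. *)
Lemma ae_cvg_measurable (f : nat -> T -> R) (g : T -> R) :
  (forall n, measurable_fun setT (f n)) ->
  {ae mu, forall x, f n x @[n --> \oo] --> g x} -> measurable_fun setT g.
Proof.
move=> mf fg; apply/measurable_EFinP.
apply: (@ae_measurable_fun _ _ _ mu cmu setT
    (fun x => limn_esup (fun n => (f n x)%:E))).
  apply: filterS fg => x fg _ /=.
  by have [_ ->] := cvg_limn_einf_sup (cvg_EFinr fg).
by apply: measurable_fun_limn_esup => n; exact/measurable_EFinP.
Qed.

Lemma strongly_measurable_real (g : H -> R) u : continuous g ->
  strongly_measurable mu u -> measurable_fun setT (fun x => g (u x)).
Proof.
move=> cg [s [ss su]]; apply: (@ae_cvg_measurable (fun k x => g (s k x))).
  by move=> k; exact: simple_fun_measurable.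
by apply: filterS su => x su; exact: (continuous_cvg _ (cg (u x)) su).
Qed.

Lemma strongly_measurable_dist u y : strongly_measurable mu u ->
  measurable_fun setT (fun x => `|u x - y|).
Proof.
move=> mu_u; apply: (strongly_measurable_real (g := fun z => `|z - y|)) => // z.
by apply: cvg_norm; apply: cvgB; [exact: cvg_id|exact: cvg_cst].
Qed.

Lemma strongly_measurable_sqr_norm u : strongly_measurable mu u ->
  measurable_fun setT (fun x => `|u x| ^+ 2).
Proof.
move=> mu_u; apply: (strongly_measurable_real (g := fun z => `|z| ^+ 2)) => // z.
exact: (cvgM (cvg_norm (@cvg_id _ (nbhs z))) (cvg_norm cvg_id)).
Qed.

Hypothesis sepH : separable H.

(* The approximants take, among the first points of a dense sequence, one
   closest to u x. *)
Lemma strongly_measurableP u :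
  (forall y, measurable_fun setT (fun x => `|u x - y|)) ->
  strongly_measurable mu u.
Proof.
move=> mdist; have [D DD] := separable_dense_seq sepH.
pose step k (sr : (T -> H) * (T -> R)) :=
  (fun x => if x \in [set x | `|u x - D k| < sr.2 x] then D k else sr.1 x,
   fun x => Num.min (sr.2 x) `|u x - D k|).
pose sr := fix sr k := if k is k'.+1 then step k (sr k')
  else (fun=> D 0%N, fun x => `|u x - D 0%N|).
have srP k : [/\ simple_fun (sr k).1, measurable_fun setT (sr k).2,
    forall x, (sr k).2 x = `|u x - (sr k).1 x| &
    forall x i, (i <= k)%N -> (sr k).2 x <= `|u x - D i|].
  elim: k => [|k [IHs IHm IHe IHle]].
    by split; [exact: simple_fun_cst|exact: mdist|by []|by move=> x [|i]].
  split.
  - by apply: simple_fun_if => //; exact: measurable_ltr_set (mdist _) IHm.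
  - exact: measurable_minr IHm (mdist _).
  - move=> x /=; case: ifPn; rewrite ?inE ?notin_setE /= => h.
      by rewrite min_r// ltW.
    by rewrite min_l ?IHe// -IHe leNgt; exact/negP.
  - move=> x i /=; rewrite leq_eqVlt ltnS => /orP[/eqP ->|ik].
      by rewrite ge_min lexx orbT.
    by rewrite ge_min IHle.
exists (fun k => (sr k).1); split; first by move=> k; case: (srP k).
apply: aeW => x; apply/cvgrPdist_lt => e e0.
have [i ui] := DD (u x) e e0; exists i => // k /= ik.
have [_ _ <- le_sr] := srP k; exact: le_lt_trans (le_sr x i ik) ui.
Qed.

(** By separability U is a countable union of balls centred at a dense sequence with radii 1/(j +
    1), and preimages of balls are governed by distances. The inclusion of the ball in U is built
    into [B i j], which is empty when it fails, so the union runs over all i and j. *)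
Lemma strongly_measurable_open u (U : set H) :
  strongly_measurable mu u -> open U -> measurable (u @^-1` U).
Proof.
move=> mu_u oU; have [D DD] := separable_dense_seq sepH.
pose B i j := [set x | `|u x - D i| < j.+1%:R^-1 /\
  [set y | `|y - D i| < (j.+1%:R^-1 : R)] `<=` U].
have -> : u @^-1` U = \bigcup_i \bigcup_j B i j.
  apply/seteqP; split=> [x /= Ux|x [i _ [j _ [/= ? BU]]]]; last exact: BU.
  have := oU; rewrite openE => /(_ _ Ux); rewrite /interior -nbhs_ballE.
  move=> -[e /= e0 eU]; have e20 : 0 < e / 2 by rewrite divr_gt0.
  have [j _ je] := near_infty_natSinv_lt (PosNum e20).
  have [|i ui] := DD (u x) j.+1%:R^-1; first by rewrite invr_gt0.
  exists i => //; exists j => //; split => // y /= yi; apply: eU.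
  rewrite -ball_normE /=; rewrite distrC in yi.
  have /= jj := je j (leqnn j).
  apply: le_lt_trans (ler_distD (D i) (u x) y) _.
  by rewrite [e]splitr ltrD ?(lt_trans _ jj).
apply: bigcupT_measurable => i; apply: bigcupT_measurable => j.
have [BU|nBU] := pselect ([set y | `|y - D i| < (j.+1%:R^-1 : R)] `<=` U).
  rewrite [X in measurable X](_ : _ = [set x | `|u x - D i| < j.+1%:R^-1]).
    by apply: measurable_ltr_set => //; exact: strongly_measurable_dist.
  by apply/seteqP; split=> [x []//|x].
rewrite [X in measurable X](_ : _ = set0)//.
by apply/seteqP; split=> [x []//|x].
Qed.

Lemma strongly_measurable_lsc (f : H -> \bar R) u :
  lower_semicontinuous f -> strongly_measurable mu u ->
  measurable_fun setT (f \o u).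
Proof.
move=> lscf mu_u; apply: (measurability _ (ErealGenOInfty.measurableE R)).
move=> _ [_ [a ->] <-]; rewrite setTI.
rewrite [X in measurable X](_ : _ = u @^-1` [set y | (a%:E < f y)%E]).
  by apply: strongly_measurable_open => //; exact: (lower_semicontinuousP f).1.
by apply/seteqP; split=> x /=; rewrite in_itv /= andbT.
Qed.

End strong_measurability.

(** * The space L2 and its inner product *)

Section L2_theory.
Context {R : realType} {H : completeNormedModType R} {ip : H -> H -> R}.
Context {d : measure_display} {T : measurableType d}.
Variable mu : {measure set T -> \bar R}.
Hypotheses (ipP : is_inner_product ip) (cmu : measure_is_complete mu).
Implicit Types (u v w : T -> H).

Local Notation L2 := (L2 mu).
Local Notation L2ip := (L2ip mu ip).

Lemma L2P u : L2 u <-> strongly_measurable mu u /\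
  mu.-integrable setT (EFin \o (fun x => `|u x| ^+ 2)).
Proof.
have absE : (\int[mu]_x `|(`|u x| ^+ 2)%:E|)%E = (\int[mu]_x (`|u x| ^+ 2)%:E)%E.
  by apply: eq_integral => x _; rewrite gee0_abs ?lee_fin.
split=> -[su iu]; split => //.
  apply/integrableP; split; last by rewrite absE.
  by apply/measurable_EFinP; exact: (strongly_measurable_sqr_norm cmu).
by move/integrableP : iu => [_]; rewrite absE.
Qed.

Lemma L2_integrable u : L2 u ->
  mu.-integrable setT (EFin \o (fun x => `|u x| ^+ 2)).
Proof. by move=> /L2P[_]. Qed.

Lemma L2_dominated u (g : T -> R) : strongly_measurable mu u ->
  mu.-integrable setT (EFin \o g) -> (forall x, `|u x| ^+ 2 <= g x) -> L2 u.
Proof.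
move=> su ig ug; apply/L2P; split => //; apply: le_integrable ig => //.
  by apply/measurable_EFinP; exact: (strongly_measurable_sqr_norm cmu).
move=> x _ /=; rewrite lee_fin ger0_norm ?exprn_ge0//.
exact: le_trans (ug x) (ler_norm _).
Qed.

Lemma integrable_sqr_normD u v : L2 u -> L2 v ->
  mu.-integrable setT (EFin \o (fun x => `|u x| ^+ 2 + `|v x| ^+ 2)).
Proof.
by move=> /L2_integrable iu /L2_integrable iv; have := integrableD measurableT iu iv.
Qed.

Lemma L2_ip_integrable u v : L2 u -> L2 v ->
  mu.-integrable setT (EFin \o (fun x => ip (u x) (v x))).
Proof.
move=> Lu Lv; have := integrable_sqr_normD Lu Lv; apply: le_integrable => //.
  apply/measurable_EFinP.
  (* Polarisation reduces measurability of the product to that of squared norms. *)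
  have -> : (fun x => ip (u x) (v x)) = (fun x =>
      2^-1 * (`|1 *: u x + v x| ^+ 2 - `|u x| ^+ 2 - `|v x| ^+ 2)).
    by apply/funext => x; rewrite -!(ipxx ipP) !(ipE ipP) (ipC ipP (v x)); field.
  apply: measurable_funM; first exact: measurable_cst.
  have [[su _] [sv _]] := (Lu, Lv).
  by apply: measurable_funB; [apply: measurable_funB|];
    apply: (strongly_measurable_sqr_norm cmu) => //; exact: strongly_measurable_lin.
move=> x _ /=; rewrite lee_fin (le_trans (ip_le_sqr ipP _ _))//.
by rewrite ler_norm.
Qed.

Lemma L2_lin (a : R) u v : L2 u -> L2 v -> L2 (fun x => a *: u x + v x).
Proof.
move=> Lu Lv; have [[su _] [sv _]] := (Lu, Lv).
apply: (@L2_dominated _ (fun x => 2 * (a ^+ 2 * `|u x| ^+ 2 + `|v x| ^+ 2))).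
- exact: strongly_measurable_lin.
- apply: (integrableZl measurableT 2 (f := EFin \o
    (fun x => a ^+ 2 * `|u x| ^+ 2 + `|v x| ^+ 2))).
  apply: (integrableD measurableT
    (f := EFin \o (fun x => a ^+ 2 * `|u x| ^+ 2))) (L2_integrable Lv).
  exact: (integrableZl measurableT (a ^+ 2) (L2_integrable Lu)).
- move=> x; apply: le_trans (sqr_normD_le ipP _ _) _.
  by rewrite ler_pM2l// lerD2r normrZ exprMn real_normK// num_real.
Qed.

Lemma L2B u v : L2 u -> L2 v -> L2 (fun x => u x - v x).
Proof.
move=> Lu Lv; rewrite [X in L2 X](_ : _ = fun x => (-1) *: v x + u x).
  exact: L2_lin.
by apply/funext => x; rewrite scaleN1r addrC.
Qed.

Lemma L2D u v : L2 u -> L2 v -> L2 (fun x => u x + v x).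
Proof.
move=> Lu Lv; rewrite [X in L2 X](_ : _ = fun x => 1 *: u x + v x).
  exact: L2_lin.
by apply/funext => x; rewrite scale1r.
Qed.

Lemma L2_cst0 : L2 (fun _ : T => 0 : H).
Proof.
split; last by rewrite normr0 expr0n integral0.
by exists (fun _ _ => 0 : H); split => [k|];
  [exact: simple_fun_cst|apply: aeW => x; exact: cvg_cst].
Qed.

Lemma L2ipC u v : L2ip u v = L2ip v u.
Proof. by congr fine; apply: eq_integral => x _; rewrite (ipC ipP). Qed.

Lemma L2ip_lin (a : R) u v w : L2 u -> L2 v -> L2 w ->
  L2ip (fun x => a *: u x + v x) w = a * L2ip u w + L2ip v w.
Proof.
move=> Lu Lv Lw; have iu := L2_ip_integrable Lu Lw.
have iv := L2_ip_integrable Lv Lw.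
transitivity (\int[mu]_x (a * ip (u x) (w x) + ip (v x) (w x)))%R.
  by congr fine; apply: eq_integral => x _; rewrite !(ipE ipP).
rewrite RintegralD// ?RintegralZl//.
exact: (integrableZl measurableT a iu).
Qed.

Lemma L2ipB u v w : L2 u -> L2 v -> L2 w ->
  L2ip (fun x => u x - v x) w = L2ip u w - L2ip v w.
Proof.
move=> Lu Lv Lw; have -> : (fun x => u x - v x) = (fun x => (-1) *: v x + u x).
  by apply/funext => x; rewrite scaleN1r addrC.
by rewrite L2ip_lin// mulN1r addrC.
Qed.

Lemma L2ipD u v w : L2 u -> L2 v -> L2 w ->
  L2ip (fun x => u x + v x) w = L2ip u w + L2ip v w.
Proof.
move=> Lu Lv Lw; have -> : (fun x => u x + v x) = (fun x => 1 *: u x + v x).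
  by apply/funext => x; rewrite scale1r.
by rewrite L2ip_lin// mul1r.
Qed.

Lemma L2ip_ge0 u : 0 <= L2ip u u.
Proof.
by apply: fine_ge0; apply: integral_ge0 => x _; rewrite lee_fin (ipxx ipP) exprn_ge0.
Qed.

Lemma integral_sqr_norm u : L2 u ->
  (\int[mu]_x (`|u x| ^+ 2)%:E)%E = (L2ip u u)%:E.
Proof.
move=> Lu; rewrite fineK.
  by apply: eq_integral => x _; rewrite (ipxx ipP).
exact: integrable_fin_num (L2_ip_integrable Lu Lu).
Qed.

Lemma L2ip_sqrD_le u v : L2 u -> L2 v ->
  L2ip (fun x => u x + v x) (fun x => u x + v x) <=
  2 * (L2ip u u + L2ip v v).
Proof.
move=> Lu Lv; have LD := L2D Lu Lv; have LB := L2B Lu Lv.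
have := L2ip_ge0 (fun x => u x - v x); rewrite (L2ipB Lu Lv LB).
rewrite !(L2ipC _ (fun x => u x - v x)) !(L2ipB Lu Lv)// (L2ipD Lu Lv LD).
by rewrite !(L2ipC _ (fun x => u x + v x)) !(L2ipD Lu Lv)// (L2ipC v u); lra.
Qed.

(** A square-root-free substitute for Cauchy-Schwarz, from nonnegativity of the squares of t u + v
    and t u - v; the weight t is chosen by the caller. *)
Lemma L2ip_young (t : R) u v : 0 < t -> L2 u -> L2 v ->
  `|L2ip u v| <= (t * L2ip u u + L2ip v v / t) / 2.
Proof.
move=> t0 Lu Lv.
have expand (a b : R) : L2ip (fun x => a *: u x + b *: v x) (fun x => a *: u x + b *: v x)
    = a ^+ 2 * L2ip u u + 2 * a * b * L2ip u v + b ^+ 2 * L2ip v v.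
  have LbV : L2 (fun x => b *: v x).
    rewrite [X in L2 X](_ : _ = fun x => b *: v x + 0); last first.
      by apply/funext => x; rewrite addr0.
    exact: L2_lin Lv L2_cst0.
  have Lab := L2_lin a Lu LbV.
  have bE w : L2 w -> L2ip (fun x => b *: v x) w = b * L2ip v w.
    move=> Lw; have := L2ip_lin b Lv L2_cst0 Lw.
    have -> : L2ip (fun=> 0) w = 0.
      by rewrite /Defs.L2ip; under eq_integral do rewrite (ip0l ipP); rewrite integral0.
    rewrite addr0 => <-; congr (L2ip _ w).
    by apply/funext => x; rewrite addr0.
  rewrite L2ip_lin// bE// !(L2ipC _ (fun x => _ + _)) !L2ip_lin// !bE//.
  by rewrite (L2ipC v u); ring.
have h1 := L2ip_ge0 (fun x => t *: u x + 1 *: v x); rewrite expand in h1.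
have h2 := L2ip_ge0 (fun x => t *: u x + (-1) *: v x); rewrite expand in h2.
rewrite ler_norml -(ler_pM2l t0) -[X in _ && X](ler_pM2l t0) mulrN.
have -> : t * ((t * L2ip u u + L2ip v v / t) / 2) =
    (t ^+ 2 * L2ip u u + L2ip v v) / 2.
  by field; rewrite lt0r_neq0.
by apply/andP; split; [move: h1|move: h2]; lra.
Qed.

End L2_theory.

(** * Rapidly convergent series in L2 and the gliding hump *)

Section gliding_hump.
Context {R : realType} {H : completeNormedModType R} {ip : H -> H -> R}.
Context {d : measure_display} {T : measurableType d}.
Variable mu : {measure set T -> \bar R}.
Hypotheses (ipP : is_inner_product ip) (cmu : measure_is_complete mu).
Hypothesis sepH : separable H.
Implicit Types (u v w : T -> H).

Local Notation L2 := (L2 mu).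
Local Notation L2ip := (L2ip mu ip).

Lemma L2_sum (I : Type) (s : seq I) (h : I -> T -> H) :
  (forall i, L2 (h i)) -> L2 (fun x => \sum_(i <- s) h i x).
Proof.
move=> Lh; elim: s => [|i s IHs].
  by under eq_fun do rewrite big_nil; exact: L2_cst0.
by under eq_fun do rewrite big_cons; exact: (L2D ipP).
Qed.

Section L2_series.
Variable h : nat -> T -> H.
Hypothesis Lh : forall j, L2 (h j).

Let S m x := \sum_(j < m) h j x.
(** The weight 4^j gives |h j x| <= sqrt(A k x) 2^-j for j >= k, so partial sums converge
    geometrically wherever [A k] is finite. The larger weight 8^j in [tail] leaves a factor 2^-j
    that makes [A k] integrable. *)
Let f j x : R := 4 ^+ j * `|h j x| ^+ 2.
Let A k x : \bar R := (\sum_(n <oo) (f (n + k) x)%:E)%E.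
Let tail k c := forall j, (k <= j)%N -> 8 ^+ j * L2ip (h j) (h j) <= c.

Let f_ge0 j x : 0 <= f j x.
Proof. by rewrite mulr_ge0 ?exprn_ge0. Qed.

Let LS m : L2 (S m). Proof. exact: L2_sum. Qed.

Let measurable_f j : measurable_fun setT (f j).
Proof.
apply: measurable_funM; first exact: measurable_cst.
by apply: (strongly_measurable_sqr_norm cmu); case: (Lh j).
Qed.

Let measurable_A k : measurable_fun setT (A k).
Proof.
apply: ge0_emeasurable_sum => // n; first by move=> x _ _; rewrite lee_fin.
by move=> _; apply/measurable_EFinP; exact: measurable_f.
Qed.

Let A_ge0 k x : (0 <= A k x)%E.
Proof. by apply: nneseries_ge0 => n _ _; rewrite lee_fin. Qed.

Let integral_A k c : tail k c -> (\int[mu]_x A k x <= (2 * c)%:E)%E.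
Proof.
move=> tc; have c0 : 0 <= c.
  apply: le_trans (tc k (leqnn k)).
  by rewrite mulr_ge0 ?exprn_ge0// (L2ip_ge0 _ ipP).
rewrite integral_nneseries//; last 2 first.
- by move=> n; apply/measurable_EFinP; exact: measurable_f.
- by move=> n x _; rewrite lee_fin.
apply: lime_le.
  by apply: is_cvg_nneseries => n _ _; apply: integral_ge0 => x _; rewrite lee_fin.
apply: nearW => N.
(* The induction needs the exact geometric sum 2c - 2c/2^N, not merely its bound 2c. *)
have -> : 2 * c = c / 2 ^+ N *+ 2 + (2 * c - c / 2 ^+ N *+ 2) by ring.
apply: (@le_trans _ _ (2 * c - c / 2 ^+ N *+ 2)%:E); last first.
  by rewrite lee_fin lerDr mulrn_wge0// divr_ge0// exprn_ge0.
elim: N => [|N IHN].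
  by rewrite big_nil expr0 divr1 lee_fin; lra.
rewrite big_nat_recr//=.
have intf : (\int[mu]_x (f (N + k) x)%:E)%E =
    (4 ^+ (N + k) * L2ip (h (N + k)) (h (N + k)))%:E.
  under eq_integral do rewrite EFinM.
  have mh : measurable_fun setT (fun x => (`|h (N + k)%N x| ^+ 2)%:E).
    apply/measurable_EFinP; apply: (strongly_measurable_sqr_norm cmu).
    by case: (Lh (N + k)).
  by rewrite (ge0_integralZl_EFin mu measurableT _ mh) ?(integral_sqr_norm ipP cmu).
rewrite intf; apply: le_trans (leeD IHN (lexx _)) _.
rewrite -EFinD lee_fin.
have : 4 ^+ (N + k) * L2ip (h (N + k)) (h (N + k)) <= c / 2 ^+ N.
  have := tc (N + k)%N (leq_addl _ _).
  have -> : (8 : R) = 4 * 2 by ring.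
  rewrite exprMn -mulrA mulrCA => h8.
  rewrite ler_pdivlMr ?exprn_gt0// mulrC; apply: le_trans h8.
  apply: ler_wpM2r; first by rewrite mulr_ge0 ?exprn_ge0// (L2ip_ge0 _ ipP).
  by rewrite ler_weXn2l// ?leq_addr// ler1n.
rewrite exprS invfM; lra.
Qed.

Let dist_S k x r : A k x = r%:E -> forall l m, (k <= l)%N -> (l <= m)%N ->
  `|S m x - S l x| <= 2 * Num.sqrt r * (2^-1 ^+ l - 2^-1 ^+ m).
Proof.
move=> Ar l m kl; elim: m => [|m IHm]; first by rewrite leqn0 => /eqP ->; rewrite !subrr normr0 mulr0.
rewrite leq_eqVlt => /orP[/eqP <-|]; first by rewrite !subrr normr0 mulr0.
rewrite ltnS => lm; have km := leq_trans kl lm; rewrite /S big_ord_recr/= -/(S m x) addrAC.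
apply: le_trans (ler_normD _ _) _.
have hm : `|h m x| <= Num.sqrt r * 2^-1 ^+ m.
  have : ((f m x)%:E <= A k x)%E.
    have f0 n : (0 <= (f (n + k) x)%:E)%E by rewrite lee_fin.
    apply: le_trans (nneseries_lim_ge (m - k).+1 (fun n _ _ => f0 n)).
    by rewrite big_nat_recr//= subnK// leeDr// sume_ge0.
  rewrite Ar lee_fin => fr.
  rewrite exprVn ler_pdivlMr ?exprn_gt0//.
  rewrite -(@ler_sqr _ _ (Num.sqrt r)) ?nnegrE ?mulr_ge0 ?exprn_ge0 ?sqrtr_ge0//.
  rewrite sqr_sqrtr ?(le_trans (f_ge0 m x))//.
  have e4 : (4 : R) = 2 ^+ 2 by ring.
  by move: fr; rewrite /f e4 exprAC exprMn mulrC.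
apply: le_trans (lerD (IHm lm) hm) _.
rewrite exprS; lra.
Qed.

(** The sum w is fixed before k and b, since the gliding hump uses another b for each k. The
    constant is 8 = 4 * 2: pointwise |w - S k|^2 <= 4 A k, and the integral of [A k] is at most
    2b. *)
Lemma L2_series_exists c : tail 0 c ->
  exists w, L2 w /\ forall k b, tail k b ->
    L2ip (fun x => w x - S k x) (fun x => w x - S k x) <= 8 * b.
Proof.
move=> t0; have tailS k : tail k c by move=> j _; exact: t0.
have Afin k : {ae mu, forall x, A k x \is a fin_num}.
  have : mu.-integrable setT (A k).
    apply/integrableP; split; first exact: measurable_A.
    apply: (@le_lt_trans _ _ (2 * c)%:E); last by rewrite ltry.
    apply: le_trans (integral_A (tailS k)).
    by rewrite le_eqVlt; apply/orP; left; apply/eqP; apply: eq_integral => x _;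
      rewrite gee0_abs.
  by move=> /(integrable_ae measurableT); apply: filterS => x; exact.
(* On the null set without convergence this value is arbitrary; strong measurability tolerates
   it. *)
pose w x := lim (S m x @[m --> \oo]).
have half_cvg : (2^-1 : R) ^+ m @[m --> \oo] --> (0 : R).
  by apply: cvg_expr; rewrite ger0_norm ?invr_ge0// invf_lt1// ltr1n.
have half_le1 m : (2^-1 : R) ^+ m <= 1.
  by rewrite exprn_ile1// ?invr_ge0// invf_le1// ler1n.
have Scvg : {ae mu, forall x, S m x @[m --> \oo] --> w x}.
  apply: filterS (Afin 0%N) => x Ax; suff : cvg (S m x @[m --> \oo]) by [].
  apply: cvg_of_near_dist => e e0.
  pose r := Num.sqrt (fine (A 0%N x)).
  have r0 : 0 < 2 * r + 1 by rewrite ltr_wpDl// mulr_ge0// sqrtr_ge0.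
  have er0 : 0 < e / (2 * r + 1) by rewrite divr_gt0.
  have [k _ kP] := (cvgrPdist_lt _ _).1 half_cvg _ er0.
  exists (S k x); exists k => // m /= km.
  have := dist_S (esym (fineK Ax)) (leq0n k) km; rewrite -/r distrC => dS.
  apply: le_lt_trans dS _; have /= := kP k (leqnn k).
  rewrite sub0r normrN ger0_norm ?exprn_ge0 ?invr_ge0// ltr_pdivlMr// => hk.
  have hm : 0 <= (2^-1 : R) ^+ m by rewrite exprn_ge0 ?invr_ge0.
  have hk0 : 0 <= (2^-1 : R) ^+ k by rewrite exprn_ge0 ?invr_ge0.
  have r1 : 0 <= r by exact: sqrtr_ge0.
  by nra.
have wA k : {ae mu, forall x, ((`|w x - S k x| ^+ 2)%:E <= 4%:E * A k x)%E}.
  near=> x; have Ax : A k x \is a fin_num by near: x; exact: Afin.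
  have Sx : S m x @[m --> \oo] --> w x by near: x.
  rewrite -(fineK Ax) -EFinM lee_fin.
  set r := fine (A k x).
  have r0 : 0 <= r by exact: fine_ge0.
  have Sw : `|S m x - S k x| @[m --> \oo] --> `|w x - S k x|.
    by apply: cvg_norm; apply: cvgB => //; exact: cvg_cst.
  have : `|w x - S k x| <= 2 * Num.sqrt r.
    apply: (cvgr_to_le Sw); exists k => // m /= km.
    apply: le_trans (dist_S (esym (fineK Ax)) (leqnn k) km) _.
    rewrite -/r -[leRHS]mulr1 ler_wpM2l// ?mulr_ge0 ?sqrtr_ge0//.
    by rewrite (le_trans _ (half_le1 k))// gerBl exprn_ge0 ?invr_ge0.
  move=> hw; have := ler_pM (normr_ge0 _) (normr_ge0 _) hw hw.
  by rewrite -!expr2 exprMn sqr_sqrtr// -natrX.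
have sw : strongly_measurable mu w.
  apply: strongly_measurableP => // y.
  apply: (@ae_cvg_measurable _ _ _ mu cmu (fun m x => `|S m x - y|)).
    by move=> m; apply: (strongly_measurable_dist cmu); case: (LS m).
  apply: filterS Scvg => x Sx.
  by apply: cvg_norm; apply: cvgB => //; exact: cvg_cst.
have swS k : strongly_measurable mu (fun x => w x - S k x).
  rewrite [X in strongly_measurable mu X](_ : _ = fun x => (-1) *: S k x + w x).
    by apply: strongly_measurable_lin => //; case: (LS k).
  by apply/funext => x; rewrite scaleN1r addrC.
have int_le k b : tail k b ->
    (\int[mu]_x (`|w x - S k x| ^+ 2)%:E <= (8 * b)%:E)%E.
  move=> tb; apply: (@le_trans _ _ (\int[mu]_x (4%:E * A k x))%E).
    apply: ae_ge0_le_integral => //.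
    - by apply/measurable_EFinP; exact: (strongly_measurable_sqr_norm cmu).
    - by move=> x _; rewrite mule_ge0.
    - exact: measurable_funeM.
    - by apply: filterS (wA k) => x + _.
  rewrite ge0_integralZl//; apply: (@le_trans _ _ (4%:E * (2 * b)%:E)%E).
    by rewrite lee_pmul2l// integral_A.
  by rewrite -EFinM lee_fin mulrA -natrM.
have LwS k : L2 (fun x => w x - S k x).
  by split => //; apply: le_lt_trans (int_le k c (tailS k)) _; rewrite ltry.
exists w; split.
  rewrite [X in L2 X](_ : _ = fun x => w x - S 0%N x)//.
  by apply/funext => x; rewrite /S big_ord0 subr0.
by move=> k b /int_le; rewrite (integral_sqr_norm ipP cmu)// lee_fin.
Unshelve. all: by end_near. Qed.

End L2_series.

(* Gliding hump: otherwise a subsequence along which the pairings stay away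
   from 0 can be chosen so sparse that w := \sum_k g (n k) satisfies
   <u (n k), w> = <u (n k), g (n k)> up to a small error, contradicting the
   weak convergence of u.  This avoids proving that u is bounded. *)
Lemma L2ip_strong_weak_cvg0 (g u : nat -> T -> H) :
  (forall n, L2 (g n)) -> (forall n, L2 (u n)) ->
  L2ip (g n) (g n) @[n --> \oo] --> (0 : R) ->
  (forall w, L2 w -> L2ip (u n) w @[n --> \oo] --> (0 : R)) ->
  L2ip (g n) (u n) @[n --> \oo] --> (0 : R).
Proof.
move=> Lg Lu g0 u0; apply: contrapT => ncvg.
have [e e0 einf] : exists2 e, 0 < e &
    forall N, exists2 n, (N <= n)%N & e <= `|L2ip (g n) (u n)|.
  apply: contrapT => ne; apply: ncvg; apply/cvgrPdist_lt => e e0.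
  apply: contrapT => nN; apply: ne; exists e => // N.
  apply: contrapT => nn; apply: nN; exists N => // n /= Nn.
  by rewrite sub0r normrN ltNge; apply/negP => en; apply: nn; exists n.
(* Chosen so that the remainder r after hump k has squared norm at most 8c/M = e^2/(16M); Young with
   weight e/(4M) then bounds its pairing with [u (n k)] by e/4. *)
pose c := e ^+ 2 / 128; have c0 : 0 < c by rewrite divr_gt0// exprn_gt0.
(* [K s] dominates M = 1 + |u i|^2 for every earlier index i, so a new hump is small relative to all
   earlier u at once. *)
pose K (s : seq nat) := 1 + \sum_(i <- s) (1 + L2ip (u i) (u i)).
have sq0 v : 0 <= L2ip v v by exact: (L2ip_ge0 mu ipP).
have K0 s : 0 < K s.
  by rewrite ltr_pwDl// sumr_ge0// => i _; rewrite addr_ge0.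
have /choice[nu nuP] (s : seq nat) : exists n, [/\ (size s <= n)%N,
    e <= `|L2ip (g n) (u n)|,
    `|L2ip (u n) (fun x => \sum_(j <- s) g j x)| <= e / 4 &
    8 ^+ size s * L2ip (g n) (g n) * K s <= c].
  have e40 : 0 < e / 4 by rewrite divr_gt0.
  have Ls : L2 (fun x => \sum_(j <- s) g j x) by exact: L2_sum.
  have [N1 _ N1P] := (cvgrPdist_le _ _).1 (u0 _ Ls) _ e40.
  have cK : 0 < c / (8 ^+ size s * K s) by rewrite divr_gt0// mulr_gt0// exprn_gt0.
  have [N2 _ N2P] := (cvgrPdist_le _ _).1 g0 _ cK.
  have [n] := einf (maxn (size s) (maxn N1 N2)).
  rewrite !geq_max => /and3P[sn N1n N2n] en; exists n; split => //.
    by have := N1P n N1n; rewrite sub0r normrN.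
  have := N2P n N2n; rewrite /= sub0r normrN ger0_norm// => gn.
  by rewrite mulrAC mulrC -ler_pdivlMr// mulr_gt0// exprn_gt0.
(* Course-of-values recursion: [L k] lists the first k chosen indices. *)
pose L := fix L k := if k is k'.+1 then rcons (L k') (nu (L k')) else [::].
pose n k := nu (L k).
have LE k : L k = mkseq n k.
  by elim: k => // k IHk; rewrite /= {1}IHk /mkseq -addn1 iotaD map_cat cats1.
have sizeL k : size (L k) = k by rewrite LE size_mkseq.
have nP k : [/\ (k <= n k)%N, e <= `|L2ip (g (n k)) (u (n k))|,
    `|L2ip (u (n k)) (fun x => \sum_(j < k) g (n j) x)| <= e / 4 &
    8 ^+ k * L2ip (g (n k)) (g (n k)) * K (L k) <= c].
  have sumE : (fun x => \sum_(j <- L k) g j x) = fun x => \sum_(j < k) g (n j) x.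
    apply/funext => x; rewrite LE /mkseq big_map.
    by rewrite -(big_mkord xpredT (fun j => g (n j) x)) /index_iota subn0.
  by have := nuP (L k); rewrite sizeL -/(n k) sumE.
have tail0 j : (0 <= j)%N -> 8 ^+ j * L2ip (g (n j)) (g (n j)) <= c.
  move=> _; have [_ _ _] := nP j; apply: le_trans; rewrite ler_peMr//.
    by rewrite mulr_ge0 ?exprn_ge0.
  by rewrite lerDl sumr_ge0// => i _; rewrite addr_ge0.
have [w [Lw wP]] := L2_series_exists (fun j => Lg (n j)) tail0.
(* Hump k contributes at least e; the earlier humps and the remainder take away at most e/4 each. *)
have far k : e / 2 <= `|L2ip (u (n k)) w|.
  pose M := 1 + L2ip (u (n k)) (u (n k)).
  have M0 : 0 < M by rewrite ltr_pwDl.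
  have tailk j : (k < j)%N -> 8 ^+ j * L2ip (g (n j)) (g (n j)) <= c / M.
    move=> kj; rewrite ler_pdivlMr//; have [_ _ _] := nP j; apply: le_trans.
    rewrite ler_wpM2l ?mulr_ge0 ?exprn_ge0// /K LE /mkseq big_map.
    rewrite (bigD1_seq k) ?iota_uniq ?mem_iota//=.
    by rewrite -/M addrCA lerDl addr_ge0// sumr_ge0// => i _; rewrite addr_ge0.
  have := wP k.+1 (c / M) tailk.
  set S := fun x => \sum_(j < k) g (n j) x.
  set r := fun x => w x - _ => r2.
  have LS : L2 S by exact: L2_sum.
  have LSk : L2 (fun x => \sum_(j < k.+1) g (n j) x) by exact: L2_sum.
  have Lr : L2 r by exact: (L2B ipP).
  have wE : w = fun x => r x + (S x + g (n k) x).
    by apply/funext => x; rewrite /r /S big_ord_recr/= subrK.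
  have LSg : L2 (fun x => S x + g (n k) x) by exact: (L2D ipP).
  have -> : L2ip (u (n k)) w = L2ip (u (n k)) r + (L2ip (u (n k)) S +
      L2ip (g (n k)) (u (n k))).
    rewrite {1}wE !(L2ipC mu ipP (u (n k))).
    by rewrite (L2ipD ipP cmu Lr LSg (Lu _)) (L2ipD ipP cmu LS (Lg _) (Lu _)).
  have [_ ge _ _] := nP k; have [_ _ uS _] := nP k.
  have ur : `|L2ip (u (n k)) r| <= e / 4.
    have t0 : 0 < e / (4 * M) by rewrite divr_gt0// mulr_gt0.
    apply: le_trans (L2ip_young ipP cmu t0 (Lu _) Lr) _.
    have a1 : e / (4 * M) * L2ip (u (n k)) (u (n k)) <= e / 4.
      have -> : e / (4 * M) = e / 4 / M by field; rewrite lt0r_neq0.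
      by rewrite mulrAC ler_pdivrMr// ler_pM2l ?divr_gt0// lerDr.
    have a2 : L2ip r r / (e / (4 * M)) <= e / 4.
      rewrite ler_pdivrMr//; apply: le_trans r2 _.
      rewrite /c le_eqVlt; apply/orP; left; apply/eqP; field.
      by rewrite lt0r_neq0.
    by lra.
  move: ge uS ur; rewrite -/S; move: (L2ip _ r) (L2ip _ S) (L2ip (g _) _) => a b z.
  have := lerB_normD z (a + b); have := ler_normD a b.
  rewrite [a + (b + z)]addrA [a + b + z]addrC; lra.
have e20 : 0 < e / 2 by rewrite divr_gt0.
have [N _ NP] := (cvgrPdist_lt _ _).1 (u0 w Lw) _ e20.
have [Nn _ _ _] := nP N; have /= := NP (n N) Nn.
by rewrite sub0r normrN ltNge far.
Qed.

End gliding_hump.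

(** * Integrals of convex functions and of resolvents *)

Section integral_functionals.
Context {R : realType} {H : completeNormedModType R} {ip : H -> H -> R}.
Context {d : measure_display} {T : measurableType d}.
Variable mu : {measure set T -> \bar R}.
Hypotheses (ipP : is_inner_product ip) (cmu : measure_is_complete mu).
Hypothesis sepH : separable H.
Implicit Types (u v w : T -> H) (f : H -> \bar R) (k : R).

Local Notation L2 := (L2 mu).
Local Notation L2ip := (L2ip mu ip).

Lemma dominated_convergence_real (F : nat -> T -> R) (f g : T -> R) :
  (forall n, measurable_fun setT (F n)) ->
  (forall x, F n x @[n --> \oo] --> f x) ->
  mu.-integrable setT (EFin \o g) ->
  (forall n x, 0 <= F n x <= g x) ->
  (\int[mu]_x (F n x)%:E @[n --> \oo] --> \int[mu]_x (f x)%:E)%E.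
Proof.
move=> mF Ff ig Fg.
have mF' n : measurable_fun setT (EFin \o F n) by exact/measurable_EFinP.
have Ff' x : setT x -> ((EFin \o F n) x @[n --> \oo] --> (EFin \o f) x)%E.
  by move=> _; exact: cvg_EFinr.
have mf : measurable_fun setT (EFin \o f).
  exact: emeasurable_fun_cvg mF' Ff'.
have [||_ _ //] := dominated_convergence measurableT mF' mf _ ig.
- by apply: aeW => x; exact: Ff'.
- by apply: aeW => x n _; rewrite /= lee_fin ger0_norm; have /andP[] := Fg n x.
Qed.

(** Here g may change sign and the integral of F may be infinite, so that case is settled first. *)
Lemma le_integral_ge0 (g : T -> R) (F : T -> \bar R) :
  mu.-integrable setT (EFin \o g) -> measurable_fun setT F ->
  (forall x, (0 <= F x)%E) -> (forall x, ((g x)%:E <= F x)%E) ->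
  (\int[mu]_x (g x)%:E <= \int[mu]_x F x)%E.
Proof.
move=> ig mF F0 gF; have [Ffin|] := ltP (\int[mu]_x F x)%E +oo%E; last first.
  by rewrite leye_eq => /eqP ->; rewrite leey.
apply: le_integral => //; apply/integrableP; split => //.
by under eq_integral do rewrite gee0_abs//.
Qed.

Lemma integrable_cst_or (C : R) : C = 0 \/ (mu setT < +oo)%E ->
  mu.-integrable setT (EFin \o (fun=> C)).
Proof.
move=> Cmu; apply/integrableP; split; first exact: measurable_cst.
rewrite [X in (X < _)%E](_ : _ = \int[mu]_x cst `|C|%:E x)%E//.
rewrite integral_cst//; case: Cmu => [->|muT]; first by rewrite normr0 mul0e.
by rewrite lte_mul_pinfty// lee_fin.
Qed.

Lemma measurable_lsc_comp f u : lower_semicontinuous f -> L2 u ->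
  measurable_fun setT (f \o u).
Proof. by move=> lscf [su _]; exact: (strongly_measurable_lsc cmu sepH). Qed.

(* On a space of infinite measure, an L2 function takes values arbitrarily
   close to 0 on which f is arbitrarily small. *)
Lemma lsc_fun0_eq0 f u : nonneg_fun f -> lower_semicontinuous f ->
  L2 u -> (\int[mu]_x f (u x) < +oo)%E -> mu setT = +oo%E -> f 0 = 0%E.
Proof.
move=> f0 lscf Lu intf muT; apply/eqP; rewrite eq_le f0 andbT leNgt.
apply/negP => /lt_EFin_between[c c0 cf].
have [V + Vc] := lscf 0 c cf; rewrite -nbhs_ballE => -[r /= r0 rV].
have r20 : 0 < r ^+ 2 by rewrite exprn_gt0.
(* Where |u| < r one has f(u) > c, elsewhere |u|^2 >= r^2; so |u|^2 + f(u) >= m everywhere and its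
   integral would be infinite. *)
pose m := Num.min (r ^+ 2) c.
have m0 : 0 < m by rewrite lt_min r20.
have msq : measurable_fun setT (fun x => (`|u x| ^+ 2)%:E).
  by apply/measurable_EFinP; apply: (strongly_measurable_sqr_norm cmu); case: Lu.
have mfu := measurable_lsc_comp lscf Lu.
have : (\int[mu]_x m%:E <= \int[mu]_x ((`|u x| ^+ 2)%:E + f (u x)))%E.
  apply: ge0_le_integral => //.
  - by move=> x _; rewrite lee_fin ltW.
  - exact: emeasurable_funD.
  - move=> x _; have [ur|ru] := ltP `|u x| r.
      apply: (@le_trans _ _ (f (u x))); last by rewrite leeDr.
      apply: (@le_trans _ _ c%:E); first by rewrite lee_fin ge_min lexx orbT.
      by apply/ltW/Vc/rV; rewrite -ball_normE /= sub0r normrN.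
    apply: (@le_trans _ _ (`|u x| ^+ 2)%:E); last by rewrite leeDl.
    by rewrite lee_fin ge_min ler_sqr ?nnegrE ?ru// ltW.
rewrite (ge0_integralD mu measurableT _ msq _ mfu)//=.
rewrite integral_cst// muT gt0_muley ?lte_fin// leye_eq => /eqP.
by have := lte_add_pinfty Lu.2 intf => /[swap] ->; rewrite ltxx.
Qed.

Section resolvent_L2.
Variables (f : H -> \bar R) (k C : R).
Hypotheses (gf : proper_lsc_convex f) (k0 : 0 < k).
Hypotheses (Cmu : C = 0 \/ (mu setT < +oo)%E) (JC : `|resolvent ip f k 0| <= C).
Local Notation J := (resolvent ip f k).

Lemma L2_resolvent u : L2 u -> L2 (fun x => J (u x)).
Proof.
move=> Lu; have [su _] := Lu.
have iC : mu.-integrable setT (EFin \o (fun=> C ^+ 2)).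
  by apply: integrable_cst_or; case: Cmu => [->|]; [left; rewrite expr0n|right].
apply: (@L2_dominated _ _ _ _ _ cmu _ (fun x => 2 * (`|u x| ^+ 2 + C ^+ 2))).
- by apply: (strongly_measurable_comp (g := J)) => //; exact: continuous_resolvent.
- exact: (integrableZl measurableT 2 (integrableD measurableT (L2_integrable cmu Lu) iC)).
- move=> x; have := resolvent_norm_le ipP gf k0 (u x) JC; have C0 := le_trans (normr_ge0 _) JC.
  have := normr_ge0 (J (u x)); have := normr_ge0 (u x).
  have := sqr_ge0 (`|u x| - C); nra.
Qed.

Lemma measurable_prox_energy u : L2 u ->
  measurable_fun setT (fun x => prox_energy ip f k (u x)).
Proof.
move=> Lu; have LJ := L2_resolvent Lu; apply: measurable_funD.
  apply: (@measurableT_comp _ _ _ _ _ _ fine); first exact: fine_measurable.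
  by have [_ _ lscf _] := gf; exact: measurable_lsc_comp.
apply: measurable_funM; first exact: measurable_cst.
by apply: (strongly_measurable_sqr_norm cmu); case: (L2B ipP cmu Lu LJ).
Qed.

End resolvent_L2.

End integral_functionals.

(** * Mosco convergence of the integral functionals *)

Section mosco_integral.
Context {R : realType} {H : completeNormedModType R} {ip : H -> H -> R}.
Context {d : measure_display} {T : measurableType d}.
Variable mu : {measure set T -> \bar R}.
Context {phin : nat -> H -> \bar R} {phi : H -> \bar R}.
Hypotheses (ipP : is_inner_product ip) (cmu : measure_is_complete mu).
Hypothesis sepH : separable H.
Hypothesis gphin : forall n, proper_lsc_convex (phin n).
Hypothesis gphi : proper_lsc_convex phi.
Hypothesis mosco : Mosco setT (weak_cvg ip) strong_cvg phin phi.
(* All that is needed from condition (N) when mu is infinite. *)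
Hypothesis normal : (mu setT < +oo)%E \/
  ((forall n, phin n 0 = 0%E) /\ phi 0 = 0%E).
Implicit Types (u v w : T -> H).

Local Notation L2 := (L2 mu).
Local Notation L2ip := (L2ip mu ip).
Local Notation Jn k n := (resolvent ip (phin n) k).
Local Notation J k := (resolvent ip phi k).
Local Notation En k n := (prox_energy ip (phin n) k).
Local Notation E k := (prox_energy ip phi k).

(** For infinite [mu] the values at 0 vanish and C = 0 works. Otherwise C comes from convergence of
    the resolvents and energies at 0, and it passes to the limit [J k 0]. *)
Lemma resolvent_uniform_bound k : 0 < k -> exists C : R,
  [/\ C = 0 \/ (mu setT < +oo)%E, `|J k 0| <= C &
      forall n, `|Jn k n 0| <= C /\ fine (phin n (Jn k n 0)) <= C].
Proof.
move=> k0; case: normal => [muT|[phin0 phi0]]; last first.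
  exists 0; split; first by left.
    by rewrite (resolvent0 ipP)// normr0.
  by move=> n; rewrite (resolvent0 ipP)// phin0 normr0.
have [C CP] := mosco_resolvent_bounded ipP sepH gphin gphi mosco 0 k0.
exists C; split; [by right| |exact: CP].
have normcvg : `|Jn k n 0| @[n --> \oo] --> `|J k 0|.
  by apply: cvg_norm; exact: mosco_resolvent_cvg.
by apply: (cvgr_to_le normcvg); apply: nearW => n; case: (CP n).
Qed.

Section fixed_parameter.
Variables (k : R) (u : T -> H).
Hypotheses (k0 : 0 < k) (Lu : L2 u).

Lemma L2_Jn n : L2 (fun x => Jn k n (u x)).
Proof.
have [C [Cmu _ /(_ n)[JC _]]] := resolvent_uniform_bound k0.
exact: (L2_resolvent ipP cmu (gphin n) k0 Cmu JC).
Qed.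

Lemma L2_J : L2 (fun x => J k (u x)).
Proof.
have [C [Cmu JC _]] := resolvent_uniform_bound k0.
exact: (L2_resolvent ipP cmu gphi k0 Cmu JC).
Qed.

Lemma L2_resolvent_cvg :
  L2ip (fun x => J k (u x) - Jn k n (u x)) (fun x => J k (u x) - Jn k n (u x))
    @[n --> \oo] --> (0 : R).
Proof.
have [C [Cmu JC CP]] := resolvent_uniform_bound k0.
have C0 := le_trans (normr_ge0 _) JC.
have Ld n := L2B ipP cmu L2_J (L2_Jn n).
have iC : mu.-integrable setT (EFin \o (fun=> 8 * C ^+ 2)).
  by apply: integrable_cst_or; case: Cmu => [->|]; [left; rewrite expr0n mulr0|right].
have iu := integrableZl measurableT 8 (L2_integrable cmu Lu).
(* Both resolvents are bounded by |u| + C, so the squared difference is at most 4(|u| + C)^2. *)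
have ig : mu.-integrable setT (EFin \o (fun x => 8 * `|u x| ^+ 2 + 8 * C ^+ 2)).
  by have := integrableD measurableT iu iC.
have := @dominated_convergence_real _ _ _ mu
  (fun n x => `|J k (u x) - Jn k n (u x)| ^+ 2) (fun=> 0) _ _ _ ig.
rewrite integral0 => cvg0.
apply: fine_cvg; rewrite (_ : (fun n => _) = fun n =>
    \int[mu]_x (`|J k (u x) - Jn k n (u x)| ^+ 2)%:E)%E; last first.
  by apply/funext => n; apply: eq_integral => x _; rewrite (ipxx ipP).
apply: cvg0.
- by move=> n; apply: (strongly_measurable_sqr_norm cmu); case: (Ld n).
- move=> x; have := mosco_resolvent_cvg ipP sepH gphin gphi mosco (y := u x) k0.
  move=> /(cvgB (cvg_cst (J k (u x)))) /cvg_sqr_norm.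
  by rewrite subrr normr0 expr0n.
- move=> n x; rewrite exprn_ge0//=.
  have := ler_normB (J k (u x)) (Jn k n (u x)).
  have := resolvent_norm_le ipP gphi k0 (u x) JC.
  have := resolvent_norm_le ipP (gphin n) k0 (u x) (CP n).1.
  have := normr_ge0 (J k (u x) - Jn k n (u x)); have := normr_ge0 (u x).
  have := sqr_ge0 (`|u x| - C).
  move: `|J k (u x) - _| `|J k (u x)| `|Jn k n (u x)| `|u x| => a b c z h z0 a0 hc hb ha.
  have az : a <= 2 * (z + C) by lra.
  have := ler_pM a0 a0 az az; rewrite -!expr2; nra.
Qed.

Let prox_energy_dominated : exists2 g : T -> R,
  mu.-integrable setT (EFin \o g) & forall n x, 0 <= En k n (u x) <= g x.
Proof.
have [C [Cmu JC CP]] := resolvent_uniform_bound k0.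
exists (fun x => 4 * k * `|u x| ^+ 2 + (C + 4 * k * C ^+ 2)).
  have iC : mu.-integrable setT (EFin \o (fun=> C + 4 * k * C ^+ 2)).
    apply: integrable_cst_or; case: Cmu => [->|]; last by right.
    by left; rewrite expr0n mulr0 addr0.
  have iu := integrableZl measurableT (4 * k) (L2_integrable cmu Lu).
  by have := integrableD measurableT iu iC.
move=> n x; rewrite (prox_energy_ge0 (gphin n) k0)/=.
have := prox_energy_bound ipP (gphin n) k0 (u x) (CP n).1 (CP n).2; lra.
Qed.

Let measurable_En n : measurable_fun setT (fun x => En k n (u x)).
Proof.
have [C [Cmu _ /(_ n)[JC _]]] := resolvent_uniform_bound k0.
exact: (measurable_prox_energy ipP cmu sepH (gphin n) k0 Cmu JC).
Qed.

Lemma integrable_prox_energy n :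
  mu.-integrable setT (EFin \o (fun x => En k n (u x))).
Proof.
have [g ig Eg] := prox_energy_dominated; apply: le_integrable ig => //.
  by apply/measurable_EFinP; exact: measurable_En.
move=> x _ /=; have /andP[E0 {}Eg] := Eg n x.
by rewrite lee_fin ger0_norm// (le_trans Eg)// ler_norm.
Qed.

Lemma integral_prox_energy_cvg :
  (\int[mu]_x (En k n (u x))%:E @[n --> \oo] --> \int[mu]_x (E k (u x))%:E)%E.
Proof.
have [g ig Eg] := prox_energy_dominated.
apply: (dominated_convergence_real _ _ ig Eg) => // x.
exact: mosco_prox_energy_cvg.
Qed.

Lemma measurable_E : measurable_fun setT (fun x => E k (u x)).
Proof.
have [C [Cmu JC _]] := resolvent_uniform_bound k0.
exact: (measurable_prox_energy ipP cmu sepH gphi k0 Cmu JC).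
Qed.

End fixed_parameter.

Lemma integral_prox_energy_le_liminf k (un : nat -> T -> H) u : 0 < k ->
  (forall n, L2 (un n)) -> L2 u -> L2_weak_cvg mu ip un u ->
  (\int[mu]_x (E k (u x))%:E <=
    limn_einf (fun n => \int[mu]_x phin n (un n x)))%E.
Proof.
move=> k0 Lun Lu unu.
have LJ := L2_J k0 Lu; have LJn := L2_Jn k0 Lu.
pose dn n x := un n x - u x; pose an n x := u x - Jn k n (u x).
have Ld n : L2 (dn n) by exact: (L2B ipP).
have La n : L2 (an n) by exact: (L2B ipP).
pose cn n := k * L2ip (an n) (dn n).
have lower n : (\int[mu]_x (En k n (u x))%:E + (cn n)%:E <=
    \int[mu]_x phin n (un n x))%E.
  have iE := integrable_prox_energy k0 Lu n.
  have iad := L2_ip_integrable ipP cmu (La n) (Ld n).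
  have ikad := integrableZl measurableT k iad.
  have iad_fin := integrable_fin_num measurableT iad.
  have -> : ((cn n)%:E = \int[mu]_x (k * ip (an n x) (dn n x))%:E)%E.
    rewrite /cn /Defs.L2ip EFinM fineK//.
    by under [RHS]eq_integral do rewrite EFinM; rewrite integralZl.
  rewrite -integralD_EFin//; apply: (@le_integral_ge0 _ _ _ mu
    (fun x => En k n (u x) + k * ip (an n x) (dn n x))).
  - by have := integrableD measurableT iE ikad.
  - by have [_ _ lscf _] := gphin n; exact: (measurable_lsc_comp cmu sepH lscf (Lun n)).
  - by move=> x; case: (gphin n).
  - by move=> x; exact: (prox_energy_ineq ipP (gphin n) k0).
have dn0 w : L2 w -> L2ip (dn n) w @[n --> \oo] --> (0 : R).
  move=> Lw; rewrite (_ : (fun n => _) = fun n => L2ip (un n) w - L2ip u w).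
    by rewrite -(subrr (L2ip u w)); apply: cvgB (unu w Lw) (cvg_cst _).
  by apply/funext => n; rewrite (L2ipB ipP cmu).
have cn0 : cn n @[n --> \oo] --> (0 : R).
  rewrite -[X in _ --> X](mulr0 k); apply: cvgM; first exact: cvg_cst.
  have La' : L2 (fun x => u x - J k (u x)) by exact: (L2B ipP).
  have Lg n : L2 (fun x => J k (u x) - Jn k n (u x)) by exact: (L2B ipP).
  (* [an n] splits into a fixed function, paired with the weakly null [dn n], and a strongly null
     one, for which the gliding hump lemma is needed. *)
  rewrite (_ : (fun n => _) = fun n => L2ip (dn n) (fun x => u x - J k (u x)) +
      L2ip (fun x => J k (u x) - Jn k n (u x)) (dn n)).
    rewrite -[X in _ --> X](addr0 (0 : R)); apply: cvgD; first exact: dn0.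
    apply: (L2ip_strong_weak_cvg0 ipP cmu sepH) => //.
    exact: L2_resolvent_cvg.
  apply/funext => n; rewrite (L2ipC mu ipP (dn n)) -(L2ipD ipP cmu)//.
  by congr (L2ip _ (dn n)); apply/funext => x; rewrite addrA subrK.
(* The gap b - a absorbs the vanishing error [cn n]. *)
apply: limn_einf_ge => a /lt_EFin_between[b ab bE].
have ba0 : 0 < b - a by rewrite subr_gt0.
near=> n; apply: le_trans (lower n).
have bEn : (b%:E < \int[mu]_x (En k n (u x))%:E)%E.
  near: n; apply: limn_einf_gt_near.
  by have [-> _] := cvg_limn_einf_sup (integral_prox_energy_cvg k0 Lu).
have : `|0 - cn n| <= b - a by near: n; exact: (cvgrPdist_le _ _).1 cn0 _ ba0.
rewrite sub0r normrN ler_norml => /andP[cnl _].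
apply: (@le_trans _ _ (b%:E + (cn n)%:E)%E).
  by rewrite -EFinD lee_fin; lra.
by rewrite leeD2r// ltW.
Unshelve. all: by end_near. Qed.

Lemma mosco_integral_liminf (un : nat -> T -> H) u :
  (forall n, L2 (un n)) -> L2 u -> L2_weak_cvg mu ip un u ->
  (\int[mu]_x phi (u x) <= limn_einf (fun n => \int[mu]_x phin n (un n x)))%E.
Proof.
move=> Lun Lu unu; set l := limn_einf _.
have E0 j x : 0 <= E j.+1%:R (u x) by exact: (prox_energy_ge0 gphi).
have mE j : measurable_fun setT (fun x => (E j.+1%:R (u x))%:E).
  by apply/measurable_EFinP; exact: measurable_E.
apply: (@le_trans _ _
    (\int[mu]_x limn_einf (fun j => (E j.+1%:R (u x))%:E))%E).
  apply: ge0_le_integral => //.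
  - by move=> x _; case: gphi => + _ _ _; exact.
  - by have [_ _ lscf _] := gphi; exact: (measurable_lsc_comp cmu sepH lscf Lu).
  - rewrite [X in measurable_fun _ X](_ : _ =
      fun x => (- limn_esup (fun j => - (E j.+1%:R (u x))%:E))%E)//.
    apply: measurableT_comp => //; apply: measurable_fun_limn_esup => j.
    exact: measurableT_comp.
  - by move=> x _; exact: (prox_energy_liminf ipP).
have E0' j x : setT x -> (0 <= (E j.+1%:R (u x))%:E)%E by rewrite lee_fin.
apply: le_trans (fatou mu measurableT mE E0') _.
(* After Fatou every term is at most [l], so the upper limit may replace the lower one. *)
apply: le_trans (limn_einf_sup _) _; apply: limn_esup_le => a la.
apply: nearW => j; apply: ltW; apply: le_lt_trans la.
exact: integral_prox_energy_le_liminf.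
Qed.

Lemma mosco_integral_recovery v : L2 v ->
  exists vn : nat -> T -> H, [/\ forall n, L2 (vn n), L2_strong_cvg mu vn v &
    (limn_esup (fun n => \int[mu]_x phin n (vn n x)) <= \int[mu]_x phi (v x))%E].
Proof.
move=> Lv; have [phi0 _ lscphi _] := gphi.
have [Ifin|] := ltP (\int[mu]_x phi (v x))%E +oo%E; last first.
  rewrite leye_eq => /eqP ->; exists (fun=> v); split => //; last by rewrite leey.
  rewrite /L2_strong_cvg; under eq_fun do under eq_integral do
    rewrite subrr normr0 expr0n.
  by rewrite integral0; exact: cvg_cst.
have I0 : (0 <= \int[mu]_x phi (v x))%E by exact: integral_ge0.
pose I := fine (\int[mu]_x phi (v x))%E.
have IE : (\int[mu]_x phi (v x) = I%:E)%E by rewrite fineK// ge0_fin_numE.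
have I_ge0 : 0 <= I by exact: fine_ge0.
have mphiv := measurable_lsc_comp cmu sepH lscphi Lv.
pose k j : R := j.+1%:R; have k0 j : 0 < k j by [].
have LJ j := L2_J (k0 j) Lv; have LJn j n := L2_Jn (k0 j) Lv n.
(* Integrating k|v - J_k v|^2 <= E_k v <= phi v yields the rate I / k. *)
have dJ j : L2ip (fun x => v x - J (k j) (v x)) (fun x => v x - J (k j) (v x))
    <= I / k j.
  have Ld := L2B ipP cmu Lv (LJ j).
  rewrite ler_pdivlMr// mulrC -lee_fin EFinM -(integral_sqr_norm ipP cmu Ld).
  have msq : measurable_fun setT (fun x => (`|v x - J (k j) (v x)| ^+ 2)%:E).
    by apply/measurable_EFinP; apply: (strongly_measurable_sqr_norm cmu); case: Ld.
  rewrite -(ge0_integralZl_EFin mu measurableT _ msq) ?(ltW (k0 j))// -IE.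
  apply: ge0_le_integral => //.
  - by move=> x _; rewrite -EFinM lee_fin mulr_ge0// ltW.
  - exact: measurable_funeM.
  - move=> x _; apply: le_trans (prox_energy_le ipP gphi (k0 j) (v x)).
    by rewrite -EFinM lee_fin /prox_energy lerDr fine_resolvent_ge0.
pose P j n := L2ip (fun x => J (k j) (v x) - Jn (k j) n (v x))
    (fun x => J (k j) (v x) - Jn (k j) n (v x)) <= (k j)^-1 /\
  (\int[mu]_x phin n (Jn (k j) n (v x)) <= (I + (k j)^-1)%:E)%E.
have Pnear j : \forall n \near \oo, P j n.
  have kj0 : 0 < (k j)^-1 by rewrite invr_gt0.
  have [N _ NJ] := (cvgrPdist_le _ _).1 (L2_resolvent_cvg (k0 j) Lv) _ kj0.
  (* The energies of [Jn (k j) n v] are at most the integrals of [En (k j) n v], whose limit in n is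
     the integral of [E (k j) v], at most I. *)
  have [N' _ NE] : \forall n \near \oo,
      (\int[mu]_x (En (k j) n (v x))%:E < (I + (k j)^-1)%:E)%E.
    apply: limn_esup_lt_near.
    have [_ ->] := cvg_limn_einf_sup (integral_prox_energy_cvg (k0 j) Lv).
    apply: (@le_lt_trans _ _ I%:E); last by rewrite lte_fin ltrDl.
    rewrite -IE; apply: ge0_le_integral => //.
    - by move=> x _; rewrite lee_fin (prox_energy_ge0 gphi).
    - by apply/measurable_EFinP; exact: measurable_E.
    - by move=> x _; exact: (prox_energy_le ipP gphi).
  exists (maxn N N') => // n; rewrite /= geq_max => /andP[/NJ Jle /NE Ele]; split.
    by move: Jle; rewrite sub0r normrN; apply: le_trans; exact: ler_norm.
  apply: le_trans (ltW Ele); have [f0 _ lscf _] := gphin n.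
  apply: ge0_le_integral => //.
  - exact: (measurable_lsc_comp cmu sepH lscf (LJn j n)).
  - by have /integrableP[] := integrable_prox_energy (k0 j) Lv n.
  - move=> x _; rewrite -(fineK (resolvent_fin ipP (gphin n) (k0 j) (v x))).
    by rewrite lee_fin lerDl mulr_ge0// ltW.
have [kappa kappaP] := near_diagonal Pnear.
have small (c e : R) : 0 <= c -> 0 < e ->
    \forall n \near \oo, c / k (kappa n) <= e /\ P (kappa n) n.
  move=> c0 e0; have [N _ cN] := near_infty_natSinv_lt (PosNum (divr_gt0 e0 (ltr_wpDl c0 ltr01))).
  apply: filterS (kappaP N) => n [Nn Pn]; split => //.
  have /= := cN (kappa n) Nn; rewrite -/(k _) ltr_pdivlMr ?ltr_wpDl// => /ltW.
  apply: le_trans; rewrite mulrC ler_wpM2l ?invr_ge0 ?lerDl//; exact: ltW.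
exists (fun n x => Jn (k (kappa n)) n (v x)); split => //.
- rewrite /L2_strong_cvg (_ : (fun n => _) = fun n =>
      (L2ip (fun x => Jn (k (kappa n)) n (v x) - v x)
            (fun x => Jn (k (kappa n)) n (v x) - v x))%:E); last first.
    by apply/funext => n; rewrite (integral_sqr_norm ipP cmu)//; exact: (L2B ipP).
  apply: cvg_EFinr; apply/cvgrPdist_le => e e0.
  (* The squared distance to v is at most twice 1/k from [P] plus I/k from [dJ]. *)
  have c0 : 0 <= 2 * (1 + I) by rewrite mulr_ge0// addr_ge0.
  apply: filterS (small _ _ c0 e0) => n [ke [Pn _]].
  rewrite sub0r normrN ger0_norm ?(L2ip_ge0 mu ipP)//; apply: le_trans ke.
  set a := fun x => J (k (kappa n)) (v x) - Jn (k (kappa n)) n (v x) in Pn *.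
  pose b x := v x - J (k (kappa n)) (v x).
  have La : L2 a by exact: (L2B ipP).
  have Lb : L2 b by exact: (L2B ipP).
  have -> : L2ip (fun x => Jn (k (kappa n)) n (v x) - v x)
      (fun x => Jn (k (kappa n)) n (v x) - v x) =
      L2ip (fun x => a x + b x) (fun x => a x + b x).
    congr fine; apply: eq_integral => x _; rewrite !(ipxx ipP) -normrN opprB.
    by rewrite /a /b [in RHS]addrC addrA subrK.
  apply: le_trans (L2ip_sqrD_le ipP cmu La Lb) _.
  have := dJ (kappa n); move: Pn; rewrite -/b.
  by move: (L2ip a a) (L2ip b b) (k (kappa n))^-1 => A B z; lra.
- apply: limn_esup_le => a; rewrite IE lte_fin => Ia.
  have aI : 0 < a - I by rewrite subr_gt0.
  apply: filterS (small 1 _ ler01 aI) => n [ke [_ Pn]].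
  by apply: le_trans Pn _; rewrite lee_fin -lerBrDl -[_^-1]mul1r.
Qed.

End mosco_integral.

Theorem theoremB4 (R : realType) (H : completeNormedModType R)
  (ip : H -> H -> R) (d : measure_display) (T : measurableType d)
  (mu : {measure set T -> \bar R})
  (phin : nat -> H -> \bar R) (phi : H -> \bar R) :
  is_inner_product ip ->
  separable H ->
  (forall n, [/\ nonneg_fun (phin n), proper_fun (phin n),
                 lower_semicontinuous (phin n) & convex_fun (phin n)]) ->
  [/\ nonneg_fun phi, proper_fun phi, lower_semicontinuous phi & convex_fun phi] ->
  measure_is_complete mu ->
  sigma_finite setT mu ->
  condN mu ip (fun n => integral_functional mu (phin n))
              (integral_functional mu phi)
    \/ (mu setT < +oo)%E ->
  Mosco setT (weak_cvg ip) strong_cvg phin phi ->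
  Mosco (L2 mu) (L2_weak_cvg mu ip) (L2_strong_cvg mu)
    (fun n => integral_functional mu (phin n)) (integral_functional mu phi).
Proof.
move=> ipP sepH gphin gphi cmu _ condNmu mosco.
have normal : (mu setT < +oo)%E \/ ((forall n, phin n 0 = 0%E) /\ phi 0 = 0%E).
  have [|muT] := ltP (mu setT) +oo%E; [by left|right].
  have {}muT : mu setT = +oo%E by apply/eqP; rewrite -leye_eq.
  case: condNmu => [[un [vn [u [v [subn sub _ _]]]]]|]; last by rewrite muT ltxx.
  split=> [n|].
    have [Lun [_ [intn _]]] := subn n; have [f0 _ lscf _] := gphin n.
    exact: (lsc_fun0_eq0 cmu sepH f0 lscf Lun intn muT).
  have [Lu [_ [intu _]]] := sub; have [f0 _ lscf _] := gphi.
  exact: (lsc_fun0_eq0 cmu sepH f0 lscf Lu intu muT).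
split=> [un u Lun Lu unu|v Lv].
  exact: (mosco_integral_liminf ipP cmu sepH gphin gphi mosco normal Lun Lu unu).
exact: (mosco_integral_recovery ipP cmu sepH gphin gphi mosco normal Lv).
Qed.
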